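(* Let $\mathcal{T}$ be the Toeplitz algebra, realized as a graph $C^*$-algebra and equipped with the restriction of the gauge action to $\mathbb{Z}/k$. Then $\mathrm{dim}^{\mathbb{Z}/k}_{\mathrm{SLT}}(\mathcal{T})=\infty$ for every $k\ge2$.
   Context: $\mathcal{T}=C^*(V\mid V^*V=1)$ is the universal $C^*$-algebra generated by an isometry. It is realized as the graph $C^*$-algebra of the graph with two vertices $v_1,v_2$, a loop at $v_1$, and one edge from $v_1$ to $v_2$. For a finite directed graph $E=(E^0,E^1,r,s)$, $C^*(E)$ is the universal $C^*$-algebra generated by mutually orthogonal projections $P_v$ ($v\in E^0$) and partial isometries $S_e$ ($e\in E^1$) with mutually orthogonal ranges such that $S_e^*S_e=P_{r(e)}$, $S_eS_e^*\le P_{s(e)}$, and $P_v=\sum_{e\in s^{-1}(v)}S_eS_e^*$ whenever $s^{-1}(v)$ is nonempty. The gauge action of $\mathbb{S}^1$ is $S_e\mapsto\lambda S_e$, $P_v\mapsto P_v$ (under the identification with the Toeplitz algebra, $V$ is the sum of the two edge partial isometries, so the action is $V\mapsto\lambda V$); $\mathbb{Z}/k$ is identified with the $k$th roots of unity in $\mathbb{S}^1$. Strong local-triviality dimension: let a compact group $G$ act on a unital $C^*$-algebra $A$. $\mathrm{dim}^G_{\mathrm{SLT}}(A)$ is the smallest $n\ge0$ for which there is a $G$-equivariant unital $*$-homomorphism $C(E_nG)\to A$, where $E_0G=G$ (with the action on $C(G)$ given by $(\alpha_gf)(h)=f(hg)$), $E_{n+1}G=E_nG*G$ (topological join) with the diagonal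 action of $G$. If no such $n$ exists, the dimension is $\infty$. *)

(* Defs.v *)
From HB Require Import structures.
From mathcomp Require Import all_boot all_order all_algebra all_fingroup.
From mathcomp Require Import all_classical all_reals all_analysis.
From mathcomp Require Import complex.

Set Implicit Arguments.
Unset Strict Implicit.
Unset Printing Implicit Defensive.

Import Order.TTheory GRing.Theory Num.Theory.
Import numFieldNormedType.Exports.

Local Open Scope classical_set_scope.
Local Open Scope ring_scope.
Local Open Scope complex_scope.

(** * C*-algebras *)

(* The library's rings are unital, so the product of a possibly non-unital
   *-algebra over the complex numbers R[i] is introduced here. *)
HB.mixin Record Lmodule_isStarAlgebra (R : realType) A
    of GRing.Lmodule R[i] A := {
  amul : A -> A -> A;
  star : A -> A;
  amulA : associative amul;
  amulDl : left_distributive amul +%R;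
  amulDr : right_distributive amul +%R;
  amulZl : forall (c : R[i]) (a b : A), amul (c *: a) b = c *: amul a b;
  amulZr : forall (c : R[i]) (a b : A), amul a (c *: b) = c *: amul a b;
  starK : involutive star;
  starD : forall a b : A, star (a + b) = star a + star b;
  starZ : forall (c : R[i]) (a : A), star (c *: a) = c^* *: star a;
  starM : forall a b : A, star (amul a b) = amul (star b) (star a)
}.

#[short(type="starAlgType")]
HB.structure Definition StarAlgebra (R : realType) :=
  {A of GRing.Lmodule R[i] A & Lmodule_isStarAlgebra R A}.

HB.mixin Record StarAlgebra_isUnital (R : realType) A of StarAlgebra R A := {
  aone : A;
  amul1a : left_id aone amul;
  amula1 : right_id aone amul
}.

#[short(type="unitalStarAlgType")]
HB.structure Definition UnitalStarAlgebra (R : realType) :=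
  {A of StarAlgebra R A & StarAlgebra_isUnital R A}.

HB.mixin Record StarAlgebra_isCStar (R : realType) A
    of StarAlgebra R A & CompleteNormedModule R[i] A := {
  normr_amul_le : forall a b : A, `|amul a b| <= `|a| * `|b|;
  normr_cstar : forall a : A, `|amul (star a) a| = `|a| ^+ 2
}.

#[short(type="cstarAlgType")]
HB.structure Definition CStarAlgebra (R : realType) :=
  {A of StarAlgebra R A & CompleteNormedModule R[i] A
   & StarAlgebra_isCStar R A}.

#[short(type="unitalCStarAlgType")]
HB.structure Definition UnitalCStarAlgebra (R : realType) :=
  {A of CStarAlgebra R A & StarAlgebra_isUnital R A}.

(* Preservation of units is a separate requirement. *)
Definition is_star_hom (R : realType) (A B : starAlgType R) (f : A -> B) :=
  [/\ linear f, {morph f : a b / amul a b} & {morph f : a / star a}].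

(* The order of a C*-algebra: b - a is positive. *)
Definition cstar_le (R : realType) (A : cstarAlgType R) (a b : A) :=
  exists c : A, b - a = amul (star c) c.

Definition is_projection (R : realType) (A : cstarAlgType R) (p : A) :=
  star p = p /\ amul p p = p.

Definition is_partial_isometry (R : realType) (A : cstarAlgType R) (s : A) :=
  amul s (amul (star s) s) = s.

(** * The algebra C(X) *)

(* The sup norm is not needed below: a *-homomorphism between C*-algebras is a
   purely algebraic notion. *)
Definition cfun (R : realType) (X : topologicalType) :=
  continuousType X R[i]^o.

Section CFun.
Context {R : realType} {X : topologicalType}.
Implicit Types f g h : cfun R X.

HB.instance Definition _ := Choice.on (cfun R X).

Lemma conjc_continuous : continuous (@conjc R : R[i]^o -> R[i]^o).
Proof.
move=> x A /= [e e0 eA]; exists e => //= y; rewrite /ball_/= => xye.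
apply: eA; rewrite /ball_/= -rmorphB /=; move: (x - y) xye => [a b].
by rewrite !normc_def /= sqrrN.
Qed.

Lemma cfunP f g : (forall x, f x = g x) -> f = g.
Proof. by move=> fg; apply/continuousEP. Qed.

Lemma cfun0_subproof : continuous (fun _ : X => 0 : R[i]^o).
Proof. exact: cst_continuous. Qed.
Lemma cfun1_subproof : continuous (fun _ : X => 1 : R[i]^o).
Proof. exact: cst_continuous. Qed.
Lemma cfunD_subproof f g : continuous (fun x => f x + g x : R[i]^o).
Proof. by move=> x; apply: cvgD; exact: cts_fun. Qed.
Lemma cfunN_subproof f : continuous (fun x => - f x : R[i]^o).
Proof. by move=> x; apply: cvgN; exact: cts_fun. Qed.
Lemma cfunZ_subproof (c : R[i]) f : continuous (fun x => c * f x : R[i]^o).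
Proof. by move=> x; apply: cvgM; [exact: cvg_cst|exact: cts_fun]. Qed.
Lemma cfunM_subproof f g : continuous (fun x => f x * g x : R[i]^o).
Proof. by move=> x; apply: cvgM; exact: cts_fun. Qed.
Lemma cfunJ_subproof f : continuous (fun x => (f x)^* : R[i]^o).
Proof.
by move=> x; apply: continuous_comp; [exact: cts_fun|exact: conjc_continuous].
Qed.

Definition cfun0 : cfun R X := mkcts cfun0_subproof.
Definition cfun1 : cfun R X := mkcts cfun1_subproof.
Definition cfun_add f g : cfun R X := mkcts (@cfunD_subproof f g).
Definition cfun_opp f : cfun R X := mkcts (@cfunN_subproof f).
Definition cfun_scale c f : cfun R X := mkcts (@cfunZ_subproof c f).
Definition cfun_mul f g : cfun R X := mkcts (@cfunM_subproof f g).
Definition cfun_conj f : cfun R X := mkcts (@cfunJ_subproof f).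

Fact cfun_addA : associative cfun_add.
Proof. by move=> f g h; apply: cfunP => x; exact: addrA. Qed.
Fact cfun_addC : commutative cfun_add.
Proof. by move=> f g; apply: cfunP => x; exact: addrC. Qed.
Fact cfun_add0 : left_id cfun0 cfun_add.
Proof. by move=> f; apply: cfunP => x; exact: add0r. Qed.
Fact cfun_addN : left_inverse cfun0 cfun_opp cfun_add.
Proof. by move=> f; apply: cfunP => x; exact: addNr. Qed.

HB.instance Definition _ := GRing.isZmodule.Build (cfun R X)
  cfun_addA cfun_addC cfun_add0 cfun_addN.

Fact cfun_scaleA (a b : R[i]) f :
  cfun_scale a (cfun_scale b f) = cfun_scale (a * b) f.
Proof. by apply: cfunP => x; exact: mulrA. Qed.
Fact cfun_scale1 : left_id 1 cfun_scale.
Proof. by move=> f; apply: cfunP => x; exact: mul1r. Qed.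
Fact cfun_scaleDr : right_distributive cfun_scale +%R.
Proof. by move=> c f g; apply: cfunP => x; exact: mulrDr. Qed.
Fact cfun_scaleDl f : {morph cfun_scale^~ f : a b / a + b}.
Proof. by move=> a b; apply: cfunP => x; exact: mulrDl. Qed.

HB.instance Definition _ := GRing.Zmodule_isLmodule.Build R[i] (cfun R X)
  cfun_scaleA cfun_scale1 cfun_scaleDr cfun_scaleDl.

Fact cfun_mulA : associative cfun_mul.
Proof. by move=> f g h; apply: cfunP => x; exact: mulrA. Qed.
Fact cfun_mulDl : left_distributive cfun_mul +%R.
Proof. by move=> f g h; apply: cfunP => x; exact: mulrDl. Qed.
Fact cfun_mulDr : right_distributive cfun_mul +%R.
Proof. by move=> f g h; apply: cfunP => x; exact: mulrDr. Qed.
Fact cfun_mulZl (c : R[i]) f g : cfun_mul (c *: f) g = c *: cfun_mul f g.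
Proof. by apply: cfunP => x; rewrite /= /mkcts /= mulrA. Qed.
Fact cfun_mulZr (c : R[i]) f g : cfun_mul f (c *: g) = c *: cfun_mul f g.
Proof. by apply: cfunP => x; exact: mulrCA. Qed.
Fact cfun_conjK : involutive cfun_conj.
Proof. by move=> f; apply: cfunP => x; exact: conjcK. Qed.
Fact cfun_conjD f g : cfun_conj (f + g) = cfun_conj f + cfun_conj g.
Proof. by apply: cfunP => x; exact: rmorphD. Qed.
Fact cfun_conjZ (c : R[i]) f : cfun_conj (c *: f) = c^* *: cfun_conj f.
Proof. by apply: cfunP => x; exact: rmorphM. Qed.
Fact cfun_conjM f g :
  cfun_conj (cfun_mul f g) = cfun_mul (cfun_conj g) (cfun_conj f).
Proof.
by apply: cfunP => x; rewrite /= /mkcts /= mulrC; exact: rmorphM.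
Qed.

HB.instance Definition _ := Lmodule_isStarAlgebra.Build R (cfun R X)
  cfun_mulA cfun_mulDl cfun_mulDr cfun_mulZl cfun_mulZr
  cfun_conjK cfun_conjD cfun_conjZ cfun_conjM.

Fact cfun_mul1l : left_id cfun1 amul.
Proof. by move=> f; apply: cfunP => x; exact: mul1r. Qed.
Fact cfun_mul1r : right_id cfun1 amul.
Proof. by move=> f; apply: cfunP => x; exact: mulr1. Qed.

HB.instance Definition _ := StarAlgebra_isUnital.Build R (cfun R X)
  cfun_mul1l cfun_mul1r.

End CFun.

(** * Compact groups and their actions *)

HB.mixin Record isTopologicalGroup G of monoid.Group G & Topological G := {
  mulg_continuous : continuous (fun p : G * G => (p.1 * p.2)%g);
  invg_continuous : continuous (fun x : G => (x^-1)%g)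
}.

#[short(type="topGroupType")]
HB.structure Definition TopologicalGroup :=
  {G of monoid.Group G & Topological G & isTopologicalGroup G}.

HB.mixin Record TopologicalGroup_isCompact G of TopologicalGroup G := {
  compact_group : compact [set: G];
  hausdorff_group : hausdorff_space G
}.

#[short(type="compactGroupType")]
HB.structure Definition CompactGroup :=
  {G of TopologicalGroup G & TopologicalGroup_isCompact G}.

(* Each [gact g] is automatically a unital *-automorphism. *)
Record gaction (R : realType) (G : topGroupType) (A : cstarAlgType R) :=
  GAction {
    gact :> G -> A -> A;
    gact_star_hom : forall g, is_star_hom (gact g);
    gact1 : forall a, gact 1%g a = a;
    gactM : forall g h a, gact (g * h)%g a = gact g (gact h a);
    gact_continuous : forall a, continuous (gact^~ a)
  }.

Definition gaction_restrict (R : realType) (H G : topGroupType)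
    (A : cstarAlgType R) (i : H -> G)
    (iM : {morph i : x y / (x * y)%g}) (i_cont : continuous i)
    (alpha : gaction G A) : gaction H A.
Proof.
refine (@GAction R H A (fun x a => alpha (i x) a) _ _ _ _).
- by move=> x; exact: gact_star_hom.
- move=> a; have -> : i 1%g = 1%g; last exact: gact1.
  by apply: (@mulgI _ (i 1%g)); rewrite -iM !mulg1.
- by move=> x y a; rewrite iM gactM.
- move=> a x; apply: (@continuous_comp _ _ _ i (alpha^~ a)).
    exact: i_cont.
  exact: gact_continuous.
Defined.

(** ** The circle group *)

Definition circle (R : realType) : Type := [set z : R[i]^o | `|z| = 1].

Section Circle.
Context {R : realType}.

HB.instance Definition _ := Topological.copy (circle R)
  (set_type [set z : R[i]^o | `|z| = 1]).

Definition circle_val (z : circle R) : R[i] := set_val z.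

Lemma circle_valP (z : circle R) : `|circle_val z| = 1.
Proof. exact: (set_mem (valP z)). Qed.

Definition circle_of (z : R[i]) (z1 : `|z| = 1) : circle R :=
  SigSub (mem_set z1 : (z : R[i]^o) \in [set z : R[i]^o | `|z| = 1]).

Lemma circle_valE z (z1 : `|z| = 1) : circle_val (circle_of z1) = z.
Proof. by []. Qed.

Lemma circle_inj : injective circle_val.
Proof. exact: val_inj. Qed.

Fact circle1_subproof : `|1 : R[i]| = 1. Proof. exact: normr1. Qed.
Fact circleM_subproof (z w : circle R) : `|circle_val z * circle_val w| = 1.
Proof. by rewrite normrM !circle_valP mulr1. Qed.
Fact circleV_subproof (z : circle R) : `|(circle_val z)^-1| = 1.
Proof. by rewrite normfV circle_valP invr1. Qed.

Let one := circle_of circle1_subproof.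
Let mul z w := circle_of (circleM_subproof z w).
Let inv z := circle_of (circleV_subproof z).

Fact circle_unit (z : circle R) : circle_val z != 0.
Proof. by rewrite -normr_eq0 circle_valP oner_neq0. Qed.

Fact circle_mulA : associative mul.
Proof. by move=> x y z; apply: circle_inj; rewrite !circle_valE mulrA. Qed.
Fact circle_mul1l : left_id one mul.
Proof. by move=> x; apply: circle_inj; rewrite !circle_valE mul1r. Qed.
Fact circle_mul1r : right_id one mul.
Proof. by move=> x; apply: circle_inj; rewrite !circle_valE mulr1. Qed.
Fact circle_mulVl : left_inverse one inv mul.
Proof.
by move=> x; apply: circle_inj; rewrite !circle_valE mulVf ?circle_unit.
Qed.
Fact circle_mulVr : right_inverse one inv mul.
Proof.
by move=> x; apply: circle_inj; rewrite !circle_valE mulfV ?circle_unit.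
Qed.

HB.instance Definition _ := isGroup.Build (circle R)
  circle_mulA circle_mul1l circle_mul1r circle_mulVl circle_mulVr.

Lemma circle_val1 : circle_val 1%g = 1.
Proof. by []. Qed.

Lemma circle_valM (z w : circle R) :
  circle_val (z * w)%g = circle_val z * circle_val w.
Proof. by []. Qed.

Lemma circle_valX (z : circle R) n : circle_val (z ^+ n)%g = circle_val z ^+ n.
Proof.
by elim: n => [|n IHn]; rewrite ?circle_val1// expgS exprS circle_valM IHn.
Qed.

Lemma circle_val_continuous : continuous (circle_val : circle R -> R[i]^o).
Proof. exact: initial_continuous. Qed.

Fact circle_mul_continuous :
  continuous (fun p : circle R * circle R => (p.1 * p.2)%g).
Proof.
apply: continuous_comp_initial => p.
have v1 : circle_val q.1 @[q --> p] --> (circle_val p.1 : R[i]^o).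
  exact: (continuous_comp cvg_fst (@circle_val_continuous p.1)).
have v2 : circle_val q.2 @[q --> p] --> (circle_val p.2 : R[i]^o).
  exact: (continuous_comp cvg_snd (@circle_val_continuous p.2)).
exact: (cvgM v1 v2).
Qed.

Fact circle_inv_continuous : continuous (fun z : circle R => (z^-1)%g).
Proof.
apply: continuous_comp_initial => z.
exact: (cvgV (circle_unit z) (@circle_val_continuous z)).
Qed.

HB.instance Definition _ := isTopologicalGroup.Build (circle R)
  circle_mul_continuous circle_inv_continuous.

End Circle.

(** ** Finite groups and Z/k *)

Section DiscreteGroup.
Context {G : finGroupType}.
Local Notation D := (discrete_topology G).

HB.instance Definition _ := monoid.Group.copy D G.

Fact discrete_mul_continuous : continuous (fun p : D * D => (p.1 * p.2)%g).
Proof.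
move=> p A /nbhs_singleton Ap; exists ([set p.1], [set p.2]) => /=.
  by split; exact: discrete_set1.
by move=> [x y] [/= -> ->].
Qed.

Fact discrete_inv_continuous : continuous (fun x : D => (x^-1)%g).
Proof. by apply/continuousP => A _; exact: discrete_open. Qed.

HB.instance Definition _ := isTopologicalGroup.Build D
  discrete_mul_continuous discrete_inv_continuous.

Fact discrete_compact : compact [set: D].
Proof. by apply: finite_compact; exact: (@finite_finset G). Qed.

HB.instance Definition _ := TopologicalGroup_isCompact.Build D
  discrete_compact (@discrete_hausdorff D).

End DiscreteGroup.

Section RootsOfUnity.
Context {R : realType}.
Local Notation Z_ k := (discrete_topology 'Z_k).

Fact expi_subproof (t : R) : `|cos t +i* sin t| = 1.
Proof. by rewrite normc_def /= cos2Dsin2 sqrtr1. Qed.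

Definition expi (t : R) : circle R := circle_of (expi_subproof t).

Lemma expiE (t : R) : circle_val (expi t) = cos t +i* sin t.
Proof. by []. Qed.

Lemma expiX (t : R) n : (expi t ^+ n)%g = expi (t *+ n).
Proof.
elim: n => [|n IHn].
  apply: circle_inj; rewrite mulr0n circle_val1 expiE cos0 sin0.
  by apply/eqP; rewrite eq_complex /= !eqxx.
rewrite expgS IHn mulrS; apply: circle_inj; rewrite circle_valM !expiE.
apply/eqP; rewrite eq_complex /= cosD sinD eqxx /=.
by rewrite addrC [X in _ + X]mulrC [X in X + _]mulrC addrC.
Qed.

(* The identification of Z/k with the kth roots of unity (for 1 < k). *)
Definition unity_root (k : nat) (j : Z_ k) : circle R :=
  (expi (2 * pi / k%:R) ^+ nat_of_ord (j : 'Z_k))%g.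

Lemma unity_rootM (k : nat) : (1 < k)%N ->
  {morph @unity_root k : x y / (x * y)%g}.
Proof.
move=> k1 x y; rewrite /unity_root -expgD.
have zk : (expi (2 * pi / k%:R) ^+ k = 1 :> circle R)%g.
  rewrite expiX -[_ *+ k]mulr_natr divfK ?pnatr_eq0 -?lt0n ?(ltnW k1)//.
  apply: circle_inj; rewrite circle_val1 expiE mulr_natl cos2pi sin2pi.
  by apply/eqP; rewrite eq_complex /= !eqxx.
rewrite [in RHS](divn_eq (nat_of_ord (x : 'Z_k) + nat_of_ord (y : 'Z_k)) k) expgD mulnC expgM zk expg1n mul1g.
have -> : nat_of_ord (x * y : 'Z_k)%g =
  ((nat_of_ord (x : 'Z_k) + nat_of_ord (y : 'Z_k)) %% (Zp_trunc k).+2)%N by [].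
by congr (_ ^+ _)%g; congr modn; exact: Zp_cast.
Qed.

Lemma unity_root_continuous (k : nat) : continuous (@unity_root k).
Proof. by apply/continuousP => A _; exact: discrete_open. Qed.

Definition restrict_unity_roots (A : cstarAlgType R) (k : nat) (k1 : (1 < k)%N)
    (gamma : gaction (circle R) A) : gaction (Z_ k) A :=
  gaction_restrict (unity_rootM k1) (@unity_root_continuous k) gamma.

End RootsOfUnity.

(** * Joins and the spaces E_n G *)

Section Join.
Local Open Scope quotient_scope.
Context (R : realType) (X Y : topologicalType).

Definition unit_interval : Type := `[0%R : R, 1%R]%classic.
HB.instance Definition _ :=
  Topological.copy unit_interval (set_type `[0%R : R, 1%R]%classic).

Local Notation cylinder := (X * Y * unit_interval)%type.

(* Y is collapsed at t = 0 and X is collapsed at t = 1. *)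
Definition join_rel (p q : cylinder) : bool :=
  [&& p.2 == q.2,
      (set_val p.2 == 1) || (p.1.1 == q.1.1)
    & (set_val p.2 == 0) || (p.1.2 == q.1.2)].

Fact join_rel_refl : reflexive join_rel.
Proof. by move=> p; rewrite /join_rel !eqxx !orbT. Qed.
Fact join_rel_sym : symmetric join_rel.
Proof.
move=> p q; rewrite /join_rel eq_sym; case: eqP => //= ->.
by rewrite (eq_sym p.1.1) (eq_sym p.1.2).
Qed.
Fact join_rel_trans : transitive join_rel.
Proof.
move=> q p r /and3P[/eqP pq x1 y1] /and3P[/eqP qr x2 y2].
rewrite /join_rel pq qr eqxx /=; move: x1 y1 x2 y2; rewrite pq qr.
case: (set_val r.2 == 1) => /=; case: (set_val r.2 == 0) => //=.
- by move=> _ /eqP-> _ ->.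
- by move=> /eqP-> _ ->.
- by move=> /eqP-> /eqP-> -> ->.
Qed.

Canonical join_equiv := EquivRel join_rel join_rel_refl join_rel_sym
  join_rel_trans.

Definition join : topologicalType := quotient_topology {eq_quot join_equiv}.

Definition join_pi (x : X) (y : Y) (t : unit_interval) : join :=
  \pi_({eq_quot join_equiv}) (x, y, t).

Lemma join_piP (x x' : X) (y y' : Y) (t t' : unit_interval) :
  join_pi x y t = join_pi x' y' t' <-> join_rel (x, y, t) (x', y', t').
Proof. by split=> [/eqmodP|xy]; [|apply/eqmodP]. Qed.

Lemma joinW (P : join -> Prop) :
  (forall x y t, P (join_pi x y t)) -> forall c, P c.
Proof. by move=> H; elim/quotW => -[[x y] t]; exact: H. Qed.

Definition join_map (f : X -> X) (h : Y -> Y) (c : join) : join :=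
  let p := generic_quotient.repr (c : {eq_quot join_equiv}) in join_pi (f p.1.1) (h p.1.2) p.2.

Lemma join_mapE f h x y t :
  join_map f h (join_pi x y t) = join_pi (f x) (h y) t.
Proof.
rewrite /join_map; set p := generic_quotient.repr _.
have /join_piP : join_pi p.1.1 p.1.2 p.2 = join_pi x y t.
  by rewrite /join_pi -!surjective_pairing /p reprK.
move=> /and3P[/= /eqP pt px py]; apply/join_piP/and3P => /=; split.
- exact/eqP.
- by case/orP: px => [->//|/eqP ->]; rewrite eqxx orbT.
- by case/orP: py => [->//|/eqP ->]; rewrite eqxx orbT.
Qed.

Lemma join_map_continuous f h :
  continuous f -> continuous h -> continuous (join_map f h).
Proof.
move=> fc hc; apply/quotient_continuous.
have -> : join_map f h \o \pi_({eq_quot join_equiv}) =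
    \pi_(quotient_topology {eq_quot join_equiv}) \o
    (fun p : cylinder => (f p.1.1, h p.1.2, p.2)).
  by apply/funext => -[[x y] t]; exact: join_mapE.
move=> p; apply: continuous_comp; last exact: pi_continuous.
have fp : f q.1.1 @[q --> p] --> f p.1.1.
  exact: (continuous_comp (continuous_comp cvg_fst cvg_fst) (fc p.1.1)).
have hp : h q.1.2 @[q --> p] --> h p.1.2.
  exact: (continuous_comp (continuous_comp cvg_fst cvg_snd) (hc p.1.2)).
exact: (cvg_pair (cvg_pair fp hp) cvg_snd).
Qed.

End Join.

(* A right action of G; its joint continuity is not needed to act on C(X). *)
Record gspace (G : topGroupType) := GSpace {
  gspace_sort :> topologicalType;
  gtrans : gspace_sort -> G -> gspace_sort;
  gtrans_continuous : forall g, continuous (gtrans^~ g);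
  gtrans1 : forall x, gtrans x 1%g = x;
  gtransM : forall x g h, gtrans x (g * h)%g = gtrans (gtrans x g) h
}.

Fact mulgr_continuous (G : topGroupType) (g : G) :
  continuous (fun x : G => (x * g)%g).
Proof.
move=> x; apply: (@continuous_comp _ _ _ (fun x : G => (x, g))
  (fun p : G * G => (p.1 * p.2)%g)); last exact: mulg_continuous.
by apply: cvg_pair; [exact: cvg_id|exact: cvg_cst].
Qed.

Definition group_gspace (G : topGroupType) : gspace G :=
  @GSpace G G (fun x g => (x * g)%g) (@mulgr_continuous G)
    (@mulg1 G) (fun x g h => mulgA x g h).

Definition join_gspace (R : realType) (G : topGroupType) (X Y : gspace G) :
  gspace G.
Proof.
refine (@GSpace G (join R X Y)
  (fun c g => join_map (fun x : X => gtrans x g) (fun y : Y => gtrans y g) c)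
  _ _ _).
- by move=> g; apply: join_map_continuous; exact: gtrans_continuous.
- by elim/joinW => x y t; rewrite join_mapE !gtrans1.
- by elim/joinW => x y t g h; rewrite !join_mapE !gtransM.
Defined.

Fixpoint EG (R : realType) (G : topGroupType) (n : nat) : gspace G :=
  if n is m.+1 then join_gspace R (EG R G m) (group_gspace G)
  else group_gspace G.

(* The action of G on C(X): (g f)(x) = f(x g). *)
Lemma ctrans_subproof (R : realType) (G : topGroupType) (X : gspace G) (g : G)
  (f : cfun R X) : continuous (fun x : X => f (gtrans x g) : R[i]^o).
Proof.
move=> x; apply: (@continuous_comp _ _ _ (@gtrans G X ^~ g) f).
  exact: gtrans_continuous.
exact: cts_fun.
Qed.

Definition ctrans (R : realType) (G : topGroupType) (X : gspace G) (g : G)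
  (f : cfun R X) : cfun R X := mkcts (@ctrans_subproof R G X g f).

(** * The strong local-triviality dimension *)

Definition SLT_map_exists (R : realType) (G : compactGroupType)
    (A : unitalCStarAlgType R) (alpha : gaction G A) (n : nat) :=
  exists phi : cfun R (EG R G n) -> A,
    [/\ is_star_hom phi, phi aone = aone
      & forall g f, phi (ctrans g f) = alpha g (phi f)].

(* A nonempty set of natural numbers contains its infimum, and the infimum of
   the empty set is +oo. *)
Definition dim_SLT (R : realType) (G : compactGroupType)
    (A : unitalCStarAlgType R) (alpha : gaction G A) : \bar R :=
  ereal_inf [set n%:R%:E | n in [set n | SLT_map_exists alpha n]].

(** * Graph C*-algebras *)

Record digraph := Digraph {
  vertex : finType;
  edge : finType;
  source : edge -> vertex;
  range_of : edge -> vertex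
}.

Section GraphAlgebra.
Context (R : realType) (E : digraph).

Record is_CK_family (A : cstarAlgType R) (P : vertex E -> A)
    (S : edge E -> A) : Prop := {
  CK_projection : forall v, is_projection (P v);
  CK_orthogonal : forall v w, v != w -> amul (P v) (P w) = 0;
  CK_partial_isometry : forall e, is_partial_isometry (S e);
  CK_ranges : forall e f, e != f ->
    amul (amul (S e) (star (S e))) (amul (S f) (star (S f))) = 0;
  CK_source_proj : forall e, amul (star (S e)) (S e) = P (range_of e);
  CK_range_proj : forall e,
    cstar_le (amul (S e) (star (S e))) (P (source e));
  CK_sum : forall v, (exists e, source e = v) ->
    P v = \sum_(e | source e == v) amul (S e) (star (S e))
}.

Definition is_graph_algebra (A : cstarAlgType R) (P : vertex E -> A)
    (S : edge E -> A) :=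
  is_CK_family P S /\
  forall (B : cstarAlgType R) (Q : vertex E -> B) (T : edge E -> B),
    is_CK_family Q T ->
    exists! f : A -> B, [/\ is_star_hom f,
      forall v, f (P v) = Q v & forall e, f (S e) = T e].

Definition is_gauge_action (A : cstarAlgType R) (P : vertex E -> A)
    (S : edge E -> A) (gamma : gaction (circle R) A) :=
  forall z : circle R,
    (forall v, gamma z (P v) = P v) /\
    (forall e, gamma z (S e) = circle_val z *: S e).

End GraphAlgebra.

(* The vertices v_1, v_2 are true, false; the edge true is the loop at v_1 and
   the edge false goes from v_1 to v_2. *)
Definition toeplitz_graph : digraph :=
  @Digraph bool bool (fun=> true) id.

(** * The Toeplitz algebra is the universal C*-algebra of an isometry *)

Section StarAlgebraTheory.
Context (R : realType) (A : starAlgType R).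
Implicit Types a b : A.

Lemma amul0a a : amul 0 a = 0.
Proof. by have := amulZl 0 0 a; rewrite !scale0r. Qed.
Lemma amula0 a : amul a 0 = 0.
Proof. by have := amulZr 0 a 0; rewrite !scale0r. Qed.
Lemma amulNa a b : amul (- a) b = - amul a b.
Proof. by rewrite -scaleN1r amulZl scaleN1r. Qed.
Lemma amulaN a b : amul a (- b) = - amul a b.
Proof. by rewrite -scaleN1r amulZr scaleN1r. Qed.
Lemma star0 : star 0 = 0 :> A.
Proof. by have := starZ 0 (0 : A); rewrite rmorph0 !scale0r. Qed.
Lemma starN a : star (- a) = - star a.
Proof. by rewrite -scaleN1r starZ rmorphN rmorph1 scaleN1r. Qed.
Lemma star_inj : injective (@star R A).
Proof. exact: inv_inj (@starK R A). Qed.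

End StarAlgebraTheory.

Lemma star1 (R : realType) (A : unitalStarAlgType R) : star aone = aone :> A.
Proof. by rewrite -[LHS]amul1a -{1}[aone]starK -starM amul1a starK. Qed.

Section ToeplitzIsometry.
Context (R : realType) (T : unitalCStarAlgType R).
Context (P : vertex toeplitz_graph -> T) (S : edge toeplitz_graph -> T).
Hypothesis PS : is_graph_algebra P S.

Local Notation s := (S true).
Local Notation t := (S false).
Local Notation p := (P true).
Local Notation q := (P false).

Let CK := proj1 PS.

Let ss : amul (star s) s = p. Proof. exact: (CK_source_proj CK true). Qed.
Let tt : amul (star t) t = q. Proof. exact: (CK_source_proj CK false). Qed.
Let pE : p = amul s (star s) + amul t (star t).
Proof.
rewrite (CK_sum CK (v := true)); last by exists true.
by rewrite big_bool.
Qed.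
Let pq : amul p q = 0. Proof. exact: (CK_orthogonal CK). Qed.
Let qp : amul q p = 0. Proof. exact: (CK_orthogonal CK). Qed.
Let pp : amul p p = p. Proof. exact: (proj2 (CK_projection CK true)). Qed.
Let qq : amul q q = q. Proof. exact: (proj2 (CK_projection CK false)). Qed.
Let p_star : star p = p. Proof. exact: (proj1 (CK_projection CK true)). Qed.
Let q_star : star q = q. Proof. exact: (proj1 (CK_projection CK false)). Qed.
Let sp : amul s p = s.
Proof. by rewrite -ss; exact: (CK_partial_isometry CK true). Qed.
Let tq : amul t q = t.
Proof. by rewrite -tt; exact: (CK_partial_isometry CK false). Qed.
Let sq : amul s q = 0. Proof. by rewrite -sp -amulA pq amula0. Qed.
Let tp : amul t p = 0. Proof. by rewrite -tq -amulA qp amula0. Qed.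
Let st : amul (star s) t = 0.
Proof.
have ps : amul p (star s) = star s by rewrite -p_star -starM sp.
have := @CK_ranges _ _ _ _ _ CK true false isT.
move=> /(congr1 (fun a => amul (star s) (amul a t))).
by rewrite amul0a amula0 -!amulA tt tq !amulA ss ps.
Qed.
Let ts : amul (star t) s = 0.
Proof. by apply: star_inj; rewrite starM starK st star0. Qed.
Let ps : amul p s = s.
Proof. by rewrite pE amulDl -!amulA ss sp ts amula0 addr0. Qed.
Let pt : amul p t = t.
Proof. by rewrite pE amulDl -!amulA tt tq st amula0 add0r. Qed.
Let qs : amul q s = 0. Proof. by rewrite -ps amulA qp amul0a. Qed.
Let qt : amul q t = 0. Proof. by rewrite -pt amulA qp amul0a. Qed.

Local Notation e := (p + q).

Let e_star : star e = e. Proof. by rewrite starD p_star q_star. Qed.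
Let ee : amul e e = e.
Proof. by rewrite amulDl !amulDr pp pq qp qq addr0 add0r. Qed.
Let eP v : amul e (P v) = P v.
Proof. by case: v; rewrite amulDl ?pp ?qp ?pq ?qq ?addr0 ?add0r. Qed.
Let Pe v : amul (P v) e = P v.
Proof. by case: v; rewrite amulDr ?pp ?qp ?pq ?qq ?addr0 ?add0r. Qed.
Let eS x : amul e (S x) = S x.
Proof. by case: x; rewrite amulDl ?ps ?qs ?pt ?qt addr0. Qed.
Let Se x : amul (S x) e = S x.
Proof. by case: x; rewrite amulDr ?sp ?sq ?tp ?tq ?addr0 ?add0r. Qed.

Let endo_id (f : T -> T) : is_star_hom f -> (forall v, f (P v) = P v) ->
  (forall x, f (S x) = S x) -> forall a, f a = a.
Proof.
move=> fh fP fS a; have [g [_ gu]] := proj2 PS T P S CK.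
have idh : is_star_hom (@id T) by split.
by rewrite -(gu f)// (gu id).
Qed.

Let u : T := aone - (e + e).
Let eu : amul e u = - e.
Proof. by rewrite /u amulDr amula1 amulaN amulDr !ee opprD addrA subrr sub0r. Qed.
Let uu : amul u u = aone.
Proof.
by rewrite {1}/u amulDl amul1a amulNa amulDl eu -[- e - e]opprD opprK /u subrK.
Qed.
Let u_star : star u = u.
Proof. by rewrite /u starD star1 starN starD e_star. Qed.

Let u_conj a : amul e a = a -> amul a e = a -> amul u (amul a u) = a.
Proof.
move=> ea ae; have ua : amul u a = - a.
  by rewrite /u amulDl amul1a amulNa amulDl ea opprD addrA subrr sub0r.
rewrite amulA ua amulNa /u amulDr amula1 amulaN amulDr ae.
by rewrite opprB addrK.
Qed.

Let e_central a : amul e a = amul a e.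
Proof.
have uau : amul u (amul a u) = a.
  apply: (endo_id (f := fun a => amul u (amul a u))); last first.
  - by move=> x; apply: u_conj.
  - by move=> v; apply: u_conj.
  split=> [c x y|x y|x].
  - by rewrite [amul (_ *: _ + _) _]amulDl amulZl amulDr amulZr.
  - by rewrite -!amulA [amul u (amul u _)]amulA uu amul1a.
  - by rewrite !starM u_star amulA.
have : amul u a = amul a u by rewrite -{1}uau amulA uu amul1a.
rewrite /u amulDl amulDr amul1a amula1 amulNa amulaN amulDl amulDr.
move=> /addrI/oppr_inj; set x := amul e a; set y := amul a e => xy.
have : (2%:R : R[i]) *: x = 2%:R *: y by rewrite !scaler_nat !mulr2n xy.
by apply: scalerI; rewrite pnatr_eq0.
Qed.

Lemma toeplitz_unit : P true + P false = aone.
Proof.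
rewrite -[LHS]amula1; apply: (endo_id (f := amul e)) => //.
split=> [c x y|x y|x].
- by rewrite amulDr amulZr.
- rewrite -[RHS]amulA [amul x (amul e y)]amulA -e_central.
  by rewrite -[amul (amul e x) y]amulA [RHS]amulA ee.
- by rewrite starM e_star e_central.
Qed.

Lemma toeplitz_isometry : amul (star (s + t)) (s + t) = aone.
Proof.
by rewrite starD amulDl !amulDr ss st ts tt addr0 add0r toeplitz_unit.
Qed.

Let s_t : amul s (star t) = 0.
Proof. by rewrite -{1}sp -{1}tq starM q_star -amulA [amul p _]amulA pq amul0a amula0. Qed.
Let t_s : amul t (star s) = 0.
Proof. by apply: star_inj; rewrite starM starK s_t star0. Qed.

Lemma toeplitz_universal (B : unitalCStarAlgType R) (w : B) :
  amul (star w) w = aone ->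
  exists! f : T -> B, [/\ is_star_hom f, f aone = aone & f (s + t) = w].
Proof.
move=> ww; set r := amul w (star w); set r' := aone - r.
have r_star : star r = r by rewrite /r starM starK.
have rr : amul r r = r by rewrite /r -!amulA [amul _ (amul w _)]amulA ww amul1a.
have r'_star : star r' = r' by rewrite /r' starD starN star1 r_star.
have rr' : amul r r' = 0 by rewrite /r' amulDr amula1 amulaN rr subrr.
have r'r : amul r' r = 0 by rewrite /r' amulDl amul1a amulNa rr subrr.
have r'r' : amul r' r' = r' by rewrite {1}/r' amulDl amul1a amulNa rr' subr0.
pose Q (v : vertex toeplitz_graph) : B := if v then r else r'.
pose W (x : edge toeplitz_graph) : B := amul w (Q x).
have Qs v : star (Q v) = Q v by case: v.
have QQ v : amul (Q v) (Q v) = Q v by case: v.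
have Q0 v v' : v != v' -> amul (Q v) (Q v') = 0 by case: v v' => [] [].
have W_star x : star (W x) = amul (Q x) (star w) by rewrite starM Qs.
have WW x : amul (star (W x)) (W x) = Q x.
  by rewrite W_star /W amulA -[amul (amul _ _) w]amulA ww amula1 QQ.
have WV x : amul (W x) (star (W x)) = amul w (amul (Q x) (star w)).
  by rewrite W_star /W -amulA [amul (Q x) (amul _ _)]amulA QQ.
have Wsum : r = amul (W true) (star (W true)) + amul (W false) (star (W false)).
  by rewrite !WV -amulDr -amulDl /Q/= /r' addrC subrK amul1a.
have CKW : is_CK_family Q W.
  split.
  - by move=> v; split.
  - exact: Q0.
  - by move=> x; rewrite /is_partial_isometry WW /W -amulA QQ.
  - move=> x y xy; rewrite !WV -!amulA [amul (star w) (amul w _)]amulA ww amul1a.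
    by rewrite [amul (Q x) (amul _ _)]amulA Q0// amul0a amula0.
  - exact: WW.
  - move=> x; exists (star (W (~~ x))); rewrite starK.
    by case: x; rewrite /= Wsum ?addrK// addrC addKr.
  - by case=> [_|[]//]; rewrite big_bool.
have [f [[fh fP fS] fu]] := proj2 PS B Q W CKW.
have [flin fM fs] := fh.
have homD (g : T -> B) : linear g -> {morph g : a b / a + b}.
  by move=> gl a b; have := gl 1 a b; rewrite !scale1r.
have Qe : Q true + Q false = aone by rewrite /Q/= /r' addrC subrK.
exists f; split.
  split=> //; first by rewrite -toeplitz_unit homD// !fP.
  by rewrite homD// !fS /W -amulDr Qe amula1.
move=> g [gh g1 gw]; apply: fu; have [glin gM gs] := gh.
have gp : g p = r.
  rewrite -/r /r -gw -gs -gM; congr g.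
  by rewrite starD amulDl !amulDr s_t t_s addr0 add0r pE.
have gq : g q = r'.
  by apply: (addrI (g p)); rewrite -homD// toeplitz_unit g1 gp /r' addrC subrK.
have gP v : g (P v) = Q v by case: v.
split=> // x.
rewrite /W -gP -gw -gM; congr g.
by case: x; rewrite amulDl ?sp ?sq ?tp ?tq ?addr0 ?add0r.
Qed.

End ToeplitzIsometry.

(* Main.v *)
(* Write x for the generator of the representation ring of Z/k and w for a
   nontrivial character value. Over E_nG there is a unitary matrix u of
   continuous functions, graded by the character, whose graded dimension
   (columns minus rows) is (1 - x)^(n+1): the Koszul class, built along the
   joins. An equivariant map C(E_nG) -> T turns u into a graded unitary matrix
   over T, acting on l^2(N) by the representation that sends the isometry to
   the unilateral shift v. Now v raises the degree by one and commutes with u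
   up to compact operators, so in each degree the cokernels of v in the source
   and in the target of u have the same dimension, as the index does not see
   compact perturbations. These cokernels carry the graded dimensions of u,
   whence (1 - w)^(n+1) = 0 and w = 1. *)
Require Import Defs.
From HB Require Import structures.
From mathcomp Require Import all_boot all_order all_algebra all_fingroup.
From mathcomp Require Import all_classical all_reals all_analysis.
From mathcomp Require Import complex.
From mathcomp Require Import ring lra.

Set Implicit Arguments.
Unset Strict Implicit.
Unset Printing Implicit Defensive.

Import Order.TTheory GRing.Theory Num.Theory.
Import numFieldNormedType.Exports.

Local Open Scope classical_set_scope.
Local Open Scope ring_scope.
Local Open Scope complex_scope.

(** * Complex numbers *)

(** In K-theoretic terms, the unitary trivialises (1 - x)^(n+1) in the equivariant K-theory of
    C(E_nG), whereas the Toeplitz algebra with its gauge action has the equivariant K-theory of a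
    point, where this class survives: its value at w is nonzero. The index argument replaces that
    computation by linear algebra, one degree at a time. A single group element, with character
    value w, is enough, because w lives in a field without nilpotents. The algebra [T] is accessible
    only through its universal property, which produces maps into C*-algebras. A concrete target
    [toep] must therefore be built with its involution, norm and completeness. Defining it by
    compactness of commutators with the shift gives this property to every element of the image of
    [T] at once. Equivariance comes from the same universal property, the gauge action being
    implemented on l^2(N) by the diagonal unitary diag(1, w, w^2, ...). *)

Section ComplexTopology.
Context {R : realType}.
Local Notation C := (R[i]^o).

(** The norm on [R[i]] takes values in [R[i]]; a real-valued squared modulus lets sums be compared,
    and shown to converge by monotonicity, in [R]. *)
Definition sqn (z : R[i]) : R := complex.Re z ^+ 2 + complex.Im z ^+ 2.

Lemma sqnE (z : R[i]) : (sqn z)%:C = z * z^*%C.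
Proof. by rewrite -sqr_normc -add_Re2_Im2. Qed.

(* Restated because the ring structures in the library's morphism lemmas do not
   unify, when rewriting, with the ones inferred for R[i] with R : realType. *)
Lemma conjcD (z w : R[i]) : (z + w)^*%C = z^*%C + w^*%C.
Proof. exact: rmorphD. Qed.

Lemma conjcN (z : R[i]) : (- z)^*%C = - z^*%C.
Proof. exact: rmorphN. Qed.

Lemma conjcM (z w : R[i]) : (z * w)^*%C = z^*%C * w^*%C.
Proof. exact: rmorphM. Qed.

Lemma conjc_sum (I : Type) (r : seq I) (P : pred I) (F : I -> R[i]) :
  (\sum_(i <- r | P i) F i)^*%C = \sum_(i <- r | P i) (F i)^*%C.
Proof. exact: rmorph_sum. Qed.

Lemma conjc_invol (z : R[i]) : z^*%C^*%C = z.
Proof. exact: conjcK. Qed.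

Lemma sqn_ge0 (z : R[i]) : 0 <= sqn z.
Proof. by rewrite addr_ge0 ?sqr_ge0. Qed.

Lemma sqn_eq0 (z : R[i]) : (sqn z == 0) = (z == 0).
Proof. by rewrite paddr_eq0 ?sqr_ge0// !sqrf_eq0 eq_complex. Qed.

Lemma sqn0 : sqn (0 : R[i]) = 0.
Proof. by apply/eqP; rewrite sqn_eq0. Qed.

Lemma sqnM (z w : R[i]) : sqn (z * w) = sqn z * sqn w.
Proof. by case: z w => a b [c d]; rewrite /sqn /=; ring. Qed.

Lemma sqn_parallelogram (z w : R[i]) :
  sqn (z + w) + sqn (z - w) = 2 * (sqn z + sqn w).
Proof. by case: z w => a b [c d]; rewrite /sqn /=; ring. Qed.

Lemma sqn_norm (z : R[i]) : `|z| = (Num.sqrt (sqn z))%:C.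
Proof. exact: normc_def. Qed.

Lemma real_complex_continuous : continuous (real_complex R : R -> C).
Proof.
move=> x A [e /= e0 eA]; move: e0; rewrite ltcE /= => /andP[/eqP e2 e1].
exists (complex.Re e) => //= y xy; apply: eA; rewrite /ball_/= -rmorphB.
by rewrite normc_def /= expr0n addr0 sqrtr_sqr ltcE /= e2 eqxx.
Qed.

Lemma Re_dist (z w : R[i]) :
  `|complex.Re z - complex.Re w|%:C <= `|z - w|.
Proof. by case: z w => a b [c d]; exact: (normc_ge_Re ((a +i* b) - (c +i* d))). Qed.

Lemma Im_dist (z w : R[i]) :
  `|complex.Im z - complex.Im w|%:C <= `|z - w|.
Proof.
case: z w => a b [c d]; apply: le_trans (_ : `|(b - d) +i* (a - c)| <= _).
  exact: (normc_ge_Re ((b - d) +i* (a - c))).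
by rewrite !normc_def /= addrC.
Qed.

Lemma Re_continuous : continuous (@complex.Re R : C -> R).
Proof.
move=> x A [e /= e0 eA]; exists e%:C => /=; first by rewrite ltcR.
move=> y xy; apply: eA; rewrite /ball_/= -ltcR; apply: le_lt_trans xy.
exact: Re_dist.
Qed.

Lemma Im_continuous : continuous (@complex.Im R : C -> R).
Proof.
move=> x A [e /= e0 eA]; exists e%:C => /=; first by rewrite ltcR.
move=> y xy; apply: eA; rewrite /ball_/= -ltcR; apply: le_lt_trans xy.
exact: Im_dist.
Qed.

Lemma sqn_continuous : continuous (sqn : C -> R).
Proof.
move=> x.
have sqr (p : C -> R) : continuous p -> p z ^+ 2 @[z --> x] --> p x ^+ 2.
  by move=> pc; apply: (@cvg_comp _ _ _ p (fun r : R => r ^+ 2) (nbhs x) _ _ (pc x));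
    exact: exprn_continuous.
exact: cvgD (sqr _ Re_continuous) (sqr _ Im_continuous).
Qed.

Lemma complex_complete (F : set_system C) :
  ProperFilter F -> cauchy F -> cvg F.
Proof.
move=> FF /cauchyP Fc.
have Fcomp (p : C -> R) : (forall x y, `|p x - p y|%:C <= `|x - y|) ->
    cvg (p @ F).
  move=> pc; apply: R_complete; apply: cauchy_exP => e e0.
  have [x Fx] := Fc e%:C ltac:(by rewrite ltcR).
  exists (p x); rewrite /fmap /=; apply: filterS Fx => y /=.
  by rewrite /ball /= => xy; rewrite -ltcR; apply: le_lt_trans xy.
have /Fcomp re := Re_dist.
have /Fcomp im := Im_dist.
pose p := lim (complex.Re z @[z --> F]); pose q := lim (complex.Im z @[z --> F]).
apply/cvg_ex; exists (p%:C + 'i%C * q%:C : C).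
have -> : F = ((complex.Re z)%:C + 'i%C * (complex.Im z)%:C : C) @[z --> F].
  by rewrite -[LHS]/(id @ F); congr (_ @ F); apply/funext => z; rewrite -complexE.
apply: (@cvgD _ C).
  exact: (continuous_cvg _ (@real_complex_continuous p) re).
apply: (@cvgM R[i]); first exact: cvg_cst.
exact: (continuous_cvg _ (@real_complex_continuous q) im).
Qed.

End ComplexTopology.

(** * Square-summable sequences *)

Section SquareSummable.
Context (R : realType).
Local Notation C := (R[i]^o).

Definition sqsum (x : nat -> C) n : R := \sum_(i < n) sqn (x i).

Definition sqsummable : {pred (nat -> C)} :=
  fun x => `[< exists M, forall n, sqsum x n <= M >].

Lemma sqnD_le (z w : R[i]) : sqn (z + w) <= 2 * (sqn z + sqn w).
Proof. by rewrite -sqn_parallelogram lerDl sqn_ge0. Qed.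

Fact sqsummable_submod_closed : submod_closed sqsummable.
Proof.
split.
  apply/asboolP; exists 0 => n; rewrite /sqsum big1// => i _.
  by rewrite sqn0.
move=> a x y /asboolP[M xM] /asboolP[N yN].
apply/asboolP; exists (2 * (sqn a * M + N)) => n.
apply: (@le_trans _ _ (\sum_(i < n) 2 * (sqn a * sqn (x i) + sqn (y i)))).
  by apply: ler_sum => i _; apply: le_trans (sqnD_le _ _) _; rewrite sqnM.
rewrite -mulr_sumr big_split/= -mulr_sumr ler_wpM2l// lerD ?yN//.
by rewrite ler_wpM2l ?sqn_ge0 ?xM.
Qed.

HB.instance Definition _ := GRing.isSubmodClosed.Build R[i] (nat -> C) sqsummable
  sqsummable_submod_closed.

Record l2 := L2 { l2val :> nat -> C; l2valP : l2val \in sqsummable }.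

HB.instance Definition _ := [isSub for l2val].
HB.instance Definition _ := [Choice of l2 by <:].
HB.instance Definition _ := [SubChoice_isSubLmodule of l2 by <:].

Implicit Types x y z : l2.

Lemma l2P x y : (forall i, x i = y i) -> x = y.
Proof. by move=> xy; apply: val_inj; apply/funext. Qed.

Lemma l2D x y i : (x + y) i = x i + y i. Proof. by []. Qed.
Lemma l2B x y i : (x - y) i = x i - y i. Proof. by []. Qed.
Lemma l2Z c x i : (c *: x) i = c * x i. Proof. by []. Qed.
Definition sqnorm x : R := lim (sqsum x n @[n --> \oo]).

Lemma sqsum_homo (x : nat -> C) : {homo sqsum x : m n / (m <= n)%N >-> m <= n}.
Proof.
move=> m n mn; rewrite /sqsum -(subnKC mn) big_split_ord /= lerDl.
by apply: sumr_ge0 => i _; exact: sqn_ge0.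
Qed.

Lemma sqsum_cvg x : sqsum x n @[n --> \oo] --> sqnorm x.
Proof.
have /asboolP[M xM] := l2valP x.
apply: nondecreasing_is_cvgn; first exact: sqsum_homo.
by exists M => _ [n _ <-].
Qed.

Lemma sqsum_le x n : sqsum x n <= sqnorm x.
Proof. apply: nondecreasing_cvgn_le; [exact: sqsum_homo|exact: sqsum_cvg]. Qed.

Lemma sqnorm_le x M : (forall n, sqsum x n <= M) -> sqnorm x <= M.
Proof.
by move=> xM; apply: limr_le; [exact: sqsum_cvg|exact: nearW].
Qed.

Lemma sqnorm_ge0 x : 0 <= sqnorm x.
Proof. by apply: le_trans (sqsum_le x 0); rewrite /sqsum big_ord0. Qed.

Lemma sqn_coord_le x i : sqn (x i) <= sqnorm x.
Proof.
apply: le_trans (sqsum_le x i.+1); rewrite /sqsum big_ord_recr /= lerDr.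
by apply: sumr_ge0 => j _; exact: sqn_ge0.
Qed.

Lemma sqnorm_eq0 x : sqnorm x = 0 -> x = 0.
Proof.
move=> x0; apply: l2P => i; apply/eqP; rewrite -sqn_eq0 eq_le sqn_ge0 andbT.
by rewrite -x0 sqn_coord_le.
Qed.

Definition ipsum (x y : nat -> C) n : C := \sum_(i < n) x i * (y i)^*%C.

Definition ip x y : R[i] := lim (ipsum x y n @[n --> \oo]).

Lemma polarization (z w : R[i]) :
  z * w^*%C = 4%:R^-1 * ((sqn (z + w))%:C - (sqn (z - w))%:C
    + 'i%C * ((sqn (z + 'i%C * w))%:C - (sqn (z - 'i%C * w))%:C)).
Proof.
have iC : ('i%C * w)^*%C = - 'i%C * w^*%C.
  by case: w => c d; apply/eqP; rewrite eq_complex /=; apply/andP; split; apply/eqP; ring.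
rewrite !sqnE !conjcD !conjcN iC.
have := sqr_i R; rewrite expr2; move: 'i%C (z^*%C) (w^*%C) => i zc wc ii.
apply: (@mulfI _ 4%:R); first by rewrite pnatr_eq0.
rewrite [RHS]mulrA divff ?pnatr_eq0// mul1r.
have -> : 4%:R * (z * wc) = 2 * (z * wc + w * zc) - (i * i) * 2 * (z * wc - w * zc).
  by rewrite ii; ring.
ring.
Qed.

(** By polarization each partial sum is a fixed combination of four monotone sums [sqsum], which are
    bounded because square-summable sequences are closed under linear combinations. *)
Lemma ipsum_cvg x y : ipsum x y n @[n --> \oo] --> (ip x y : C).
Proof.
pose Q z n : C := (sqsum z n)%:C; pose q z : C := (sqnorm z)%:C.
have Qq z : Q z n @[n --> \oo] --> q z.
  exact: (continuous_cvg _ (@real_complex_continuous R _) (sqsum_cvg (x := z))).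
have ipE : ipsum x y = (fun n => 4%:R^-1 * (Q (x + y) n - Q (x - y) n
    + 'i%C * (Q (x + 'i%C *: y) n - Q (x - 'i%C *: y) n))).
  apply/funext => n; rewrite /ipsum /Q /sqsum !rmorph_sum /= -!sumrB mulr_sumr.
  rewrite -big_split mulr_sumr; apply: eq_bigr => i _.
  by rewrite polarization.
have ipl : ipsum x y n @[n --> \oo] --> 4%:R^-1 * (q (x + y) - q (x - y)
    + 'i%C * (q (x + 'i%C *: y) - q (x - 'i%C *: y))).
  rewrite ipE; apply: cvgM; first exact: cvg_cst.
  apply: cvgD; first exact: (cvgB (Qq _) (Qq _)).
  apply: (@cvgM R[i] _ _ _ (fun=> 'i%C)); first exact: cvg_cst.
  exact: (cvgB (Qq _) (Qq _)).
by rewrite /ip (cvg_lim (@norm_hausdorff _ C) ipl).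
Qed.

Lemma ip_unique x y (l : R[i]) : ipsum x y n @[n --> \oo] --> (l : C) ->
  ip x y = l.
Proof. by move=> xyl; rewrite /ip (cvg_lim (@norm_hausdorff _ C) xyl). Qed.

Lemma ipDl x y z : ip (x + y) z = ip x z + ip y z.
Proof.
apply: ip_unique; have -> : ipsum (x + y) z = (fun n => ipsum x z n + ipsum y z n).
  by apply/funext => n; rewrite /ipsum -big_split; apply: eq_bigr => i _; rewrite mulrDl.
exact: cvgD (ipsum_cvg (x:=_) (y:=_)) (ipsum_cvg (x:=_) (y:=_)).
Qed.

Lemma ipZl c x y : ip (c *: x) y = c * ip x y.
Proof.
apply: ip_unique; have -> : ipsum (c *: x) y = (fun n => c * ipsum x y n).
  by apply/funext => n; rewrite /ipsum mulr_sumr; apply: eq_bigr => i _; rewrite mulrA.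
by apply: (@cvgM R[i]); [exact: cvg_cst|exact: ipsum_cvg].
Qed.

Lemma ipC x y : ip y x = (ip x y)^*%C.
Proof.
apply: ip_unique; have -> : ipsum y x = (fun n => (ipsum x y n)^*%C).
  apply/funext => n; rewrite /ipsum conjc_sum; apply: eq_bigr => i _.
  by rewrite conjcM conjc_invol mulrC.
exact: (continuous_cvg _ (@conjc_continuous R _) (ipsum_cvg (x:=_) (y:=_))).
Qed.

Lemma ipxx x : ip x x = (sqnorm x)%:C.
Proof.
apply: ip_unique; have -> : ipsum x x = (fun n => (sqsum x n)%:C).
  apply/funext => n; rewrite /ipsum rmorph_sum; apply: eq_bigr => i _ /=.
  by rewrite sqnE.
exact: (continuous_cvg _ (@real_complex_continuous R _) (sqsum_cvg (x:=_))).
Qed.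

Lemma ip0l y : ip 0 y = 0.
Proof. by have := ipZl 0 0 y; rewrite scale0r mul0r. Qed.
Lemma ipNl x y : ip (- x) y = - ip x y.
Proof. by rewrite -scaleN1r ipZl mulN1r. Qed.
Lemma ipBl x y z : ip (x - y) z = ip x z - ip y z.
Proof. by rewrite ipDl ipNl. Qed.
Lemma ipDr x y z : ip x (y + z) = ip x y + ip x z.
Proof. by rewrite ipC ipDl conjcD -!ipC. Qed.
Lemma ipZr c x y : ip x (c *: y) = c^*%C * ip x y.
Proof. by rewrite ipC ipZl conjcM -ipC. Qed.
Lemma ip0r y : ip y 0 = 0.
Proof. by rewrite ipC ip0l conjc0. Qed.
Lemma ipNr x y : ip x (- y) = - ip x y.
Proof. by rewrite ipC ipNl conjcN -ipC. Qed.
Lemma ipBr x y z : ip x (y - z) = ip x y - ip x z.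
Proof. by rewrite ipDr ipNr. Qed.
Lemma ip_suml (I : Type) (r : seq I) (P : pred I) (F : I -> l2) y :
  ip (\sum_(i <- r | P i) F i) y = \sum_(i <- r | P i) ip (F i) y.
Proof. exact: (big_morph (ip^~ y) (fun a b => ipDl a b y) (ip0l y)). Qed.
Lemma ip_sumr (I : Type) (r : seq I) (P : pred I) (F : I -> l2) y :
  ip y (\sum_(i <- r | P i) F i) = \sum_(i <- r | P i) ip y (F i).
Proof. exact: (big_morph (ip y) (ipDr y) (ip0r y)). Qed.

Lemma ip_inj x y : (forall z, ip x z = ip y z) -> x = y.
Proof.
move=> xy; apply/eqP; rewrite -subr_eq0; apply/eqP/sqnorm_eq0/complexI.
by rewrite -ipxx ipBl xy subrr.
Qed.

Lemma sqnormZ c x : sqnorm (c *: x) = sqn c * sqnorm x.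
Proof.
apply: complexI; rewrite -ipxx ipZl ipZr ipxx mulrA -sqnE.
by rewrite rmorphM.
Qed.

Lemma sqnormD x y : sqnorm (x + y) = sqnorm x + sqnorm y + 2 * complex.Re (ip x y).
Proof.
apply: complexI; rewrite -ipxx ipDl !ipDr !ipxx (ipC x y) !rmorphD rmorphM /=.
have -> : (2 : R)%:C = 2%:R :> R[i] by rewrite rmorph_nat.
rewrite -addcJ; ring.
Qed.

Lemma sqnormN x : sqnorm (- x) = sqnorm x.
Proof. by rewrite -scaleN1r sqnormZ /sqn /= oppr0 expr0n addr0 sqrrN expr1n mul1r. Qed.

Lemma cauchy_schwarz x y : sqn (ip x y) <= sqnorm x * sqnorm y.
Proof.
have [y0|y0] := eqVneq (sqnorm y) 0.
  by rewrite (sqnorm_eq0 y0) ip0r sqn0 mulr_ge0 ?sqnorm_ge0.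
have {}y0 : 0 < sqnorm y by rewrite lt_neqAle eq_sym y0 sqnorm_ge0.
(* Up to the factor [sqnorm y] this is the component of [x] orthogonal to [y]; the scaling avoids a
   division. *)
have := sqnorm_ge0 ((sqnorm y)%:C *: x - ip x y *: y).
rewrite sqnormD sqnormN !sqnormZ ipNr ipZl ipZr.
have -> : sqn (sqnorm y)%:C = sqnorm y ^+ 2 by rewrite /sqn /= expr0n addr0.
set s := ip x y; have -> : complex.Re (- ((sqnorm y)%:C * (s^*%C * s))) =
    - (sqnorm y * sqn s).
  by rewrite (mulrC s^*%C) -sqnE -rmorphM.
move=> h; rewrite -subr_ge0 -(pmulr_rge0 _ y0); move: h; congr (0 <= _).
by ring.
Qed.

Definition l2norm x : R := Num.sqrt (sqnorm x).

Lemma l2norm_ge0 x : 0 <= l2norm x. Proof. exact: sqrtr_ge0. Qed.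

Lemma sqr_l2norm x : l2norm x ^+ 2 = sqnorm x.
Proof. by rewrite sqr_sqrtr ?sqnorm_ge0. Qed.

Lemma l2norm0 : l2norm 0 = 0.
Proof.
by rewrite /l2norm -(scale0r 0) sqnormZ sqn0 mul0r sqrtr0.
Qed.

Lemma l2normZ c x : l2norm (c *: x) = Num.sqrt (sqn c) * l2norm x.
Proof. by rewrite /l2norm sqnormZ sqrtrM ?sqn_ge0. Qed.

Lemma l2normN x : l2norm (- x) = l2norm x.
Proof. by rewrite /l2norm sqnormN. Qed.

Lemma Re_ip_le x y : complex.Re (ip x y) <= l2norm x * l2norm y.
Proof.
rewrite -sqrtrM ?sqnorm_ge0//; apply: le_trans (ler_norm _) _.
rewrite -sqrtr_sqr ler_wsqrtr//; apply: le_trans (cauchy_schwarz x y).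
by rewrite /sqn lerDl sqr_ge0.
Qed.

Lemma l2normD x y : l2norm (x + y) <= l2norm x + l2norm y.
Proof.
rewrite -(ler_pXn2r (n := 2))// ?nnegrE ?addr_ge0 ?l2norm_ge0//.
rewrite sqr_l2norm sqnormD -!sqr_l2norm sqrrD.
have := Re_ip_le x y; rewrite -mulr_natl; lra.
Qed.

Fact l2basis_subproof m : (fun i => (i == m)%:R : C) \in sqsummable.
Proof.
apply/asboolP; exists 1 => n; rewrite /sqsum.
have -> : \sum_(i < n) sqn ((i == m :> nat)%:R : R[i]) = \sum_(i < n | i == m :> nat) 1.
  rewrite [RHS]big_mkcond; apply: eq_bigr => i _; case: eqP => _; rewrite ?sqn0//.
  by rewrite /sqn /= expr0n addr0 expr1n.
have [mn|nm] := ltnP m n; first by rewrite (big_pred1 (Ordinal mn)).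
rewrite big_pred0 ?ler01// => i; apply/negbTE; rewrite neq_ltn.
by rewrite (leq_trans (ltn_ord i) nm).
Qed.

Definition l2basis m : l2 := L2 (l2basis_subproof m).

Lemma l2basisE m i : l2basis m i = (i == m)%:R. Proof. by []. Qed.

Lemma ip_basis x m : ip x (l2basis m) = x m.
Proof.
apply: ip_unique; apply: cvg_near_cst; exists m.+1 => // n /= mn.
rewrite /ipsum (bigD1 (Ordinal mn))//= eqxx conjc1 mulr1 big1 ?addr0//.
by move=> i; rewrite -val_eqE /= => /negbTE ->; rewrite conjc0 mulr0.
Qed.

End SquareSummable.

(** * Operators and the unilateral shift *)

Section BasicOperators.
Context {R : realType}.
Local Notation C := (R[i]^o).
Local Notation H := (l2 R).
Implicit Types x y z : H.

Lemma sqnormD_le x y : sqnorm (x + y) <= 2 * (sqnorm x + sqnorm y).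
Proof.
have : 0 <= sqnorm (x - y) by exact: sqnorm_ge0.
by rewrite !sqnormD ipNr sqnormN; case: (ip x y) => a b /=; lra.
Qed.

Fact trunc_subproof N x :
  (fun i => if (i < N)%N then x i else 0 : C) \in sqsummable (R := R).
Proof.
apply/asboolP; exists (sqnorm x) => n; apply: le_trans (sqsum_le x n).
by apply: ler_sum => i _; case: ifP => _; rewrite ?sqn0 ?sqn_ge0.
Qed.

Definition trunc N x : H := L2 (trunc_subproof N x).

Lemma truncE N x i : trunc N x i = if (i < N)%N then x i else 0.
Proof. by []. Qed.

Lemma sqnorm_trunc N x : sqnorm (trunc N x) <= sqsum x N.
Proof.
apply: sqnorm_le => n; apply: le_trans (sqsum_homo _ (leq_maxl n N)) _.
rewrite /sqsum [leRHS](big_ord_widen _ (fun i => sqn (x i)) (leq_maxr n N)).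
rewrite [leRHS]big_mkcond; apply: ler_sum => i _ /=.
by case: ifP => _; rewrite ?sqn0.
Qed.

Lemma sqnorm_tail_le N x : sqnorm (x - trunc N x) <= sqnorm x.
Proof.
apply: sqnorm_le => n; apply: le_trans (sqsum_le x n); apply: ler_sum => i _.
by rewrite l2B truncE; case: ifP => _; rewrite ?subrr ?subr0 ?sqn0 ?sqn_ge0.
Qed.

Lemma sqnorm_tail_small x (d : R) : 0 < d ->
  exists N, sqnorm (x - trunc N x) <= d.
Proof.
move=> d0; have /cvgrPdist_le/(_ _ d0)[N _ Nd] := sqsum_cvg (x := x).
exists N; have := Nd N (leqnn N); rewrite /= ger0_norm ?subr_ge0 ?sqsum_le// => {}Nd.
apply: le_trans Nd; apply: sqnorm_le => n.
rewrite lerBrDr; apply: le_trans (sqsum_le x (maxn N n)).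
apply: (@le_trans _ _ (sqsum (x - trunc N x) (maxn N n) + sqsum x N)).
  by rewrite lerD2r; apply: sqsum_homo; exact: leq_maxr.
rewrite /sqsum (big_ord_widen _ (fun i => sqn (x i)) (leq_maxl N n)).
rewrite [X in _ + X]big_mkcond -big_split; apply: ler_sum => i _.
by rewrite l2B truncE; case: ifP => _; rewrite ?subrr ?subr0 ?sqn0 /= ?add0r ?addr0.
Qed.

Definition ushiftf (x : nat -> C) i : C := if i is j.+1 then x j else 0.

Fact ushift_subproof x : ushiftf x \in sqsummable (R := R).
Proof.
apply/asboolP; exists (sqnorm x) => -[|n].
  by rewrite /sqsum big_ord0 sqnorm_ge0.
by rewrite /sqsum big_ord_recl sqn0 add0r; exact: (sqsum_le x n).
Qed.

Definition ushift x : H := L2 (ushift_subproof x).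

Fact unshift_subproof x : (fun i => x i.+1) \in sqsummable (R := R).
Proof.
apply/asboolP; exists (sqnorm x) => n; apply: le_trans (sqsum_le x n.+1).
by rewrite /sqsum big_ord_recl lerDr sqn_ge0.
Qed.

Definition unshift x : H := L2 (unshift_subproof x).

Lemma ushiftE0 x : ushift x 0%N = 0. Proof. by []. Qed.
Lemma ushiftES x i : ushift x i.+1 = x i. Proof. by []. Qed.
Lemma unshiftE x i : unshift x i = x i.+1. Proof. by []. Qed.

Lemma ushiftK : cancel ushift unshift.
Proof. by move=> x; apply: l2P. Qed.

Lemma unshiftK x : x 0%N = 0 -> ushift (unshift x) = x.
Proof. by move=> x0; apply: l2P => -[|i]; rewrite ?ushiftE0. Qed.

Lemma ip_ushift x y : ip (ushift x) y = ip x (unshift y).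
Proof.
apply: ip_unique; rewrite -(cvg_shiftS (ipsum (ushift x) y)).
have -> : [sequence ipsum (ushift x) y n.+1]_n = ipsum x (unshift y).
  by apply/funext => n; rewrite /mk_sequence /ipsum big_ord_recl mul0r add0r.
exact: ipsum_cvg.
Qed.

Lemma sqnorm_ushift x : sqnorm (ushift x) = sqnorm x.
Proof. by apply: complexI; rewrite -!ipxx ip_ushift ushiftK. Qed.

Lemma l2norm_ushift x : l2norm (ushift x) = l2norm x.
Proof. by rewrite /l2norm sqnorm_ushift. Qed.

Definition adjoint_pair (a a' : H -> H) := forall x y, ip (a x) y = ip x (a' y).

Lemma adjoint_sym a a' : adjoint_pair a a' -> adjoint_pair a' a.
Proof. by move=> aa' x y; rewrite ipC -aa' -ipC. Qed.

(** Linearity is a consequence of having an adjoint, by nondegeneracy of [ip]; this is why operators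
    are carried as bare functions. *)
Lemma adjoint_linear a a' : adjoint_pair a a' -> linear a.
Proof.
by move=> aa' c x y; apply: ip_inj => z; rewrite ipDl ipZl !aa' ipDl ipZl.
Qed.

Lemma ushift_adjoint : adjoint_pair ushift unshift.
Proof. exact: ip_ushift. Qed.

Lemma ushift_linear : linear ushift.
Proof. exact: adjoint_linear ushift_adjoint. Qed.

Lemma ushiftD x y : ushift (x + y) = ushift x + ushift y.
Proof. by have := ushift_linear 1 x y; rewrite !scale1r. Qed.
Lemma ushift0 : ushift 0 = 0.
Proof. by apply: l2P => -[]. Qed.
Lemma ushiftZ c x : ushift (c *: x) = c *: ushift x.
Proof. by have := ushift_linear c x 0; rewrite ushift0 !addr0. Qed.
Lemma ushiftB x y : ushift (x - y) = ushift x - ushift y.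
Proof. by rewrite -scaleN1r ushiftD ushiftZ scaleN1r. Qed.

Definition bounded_op (a : H -> H) :=
  exists2 M, 0 <= M & forall x, l2norm (a x) <= M * l2norm x.

(** The identity |a' x|^2 = Re <a a' x, x> gives the bound after division by |a' x|, hence the
    separate case where this norm is zero. *)
Lemma adjoint_bound a a' M : adjoint_pair a a' -> 0 <= M ->
  (forall x, l2norm (a x) <= M * l2norm x) ->
  forall x, l2norm (a' x) <= M * l2norm x.
Proof.
move=> aa' M0 aM x; have [->|a'x] := eqVneq (l2norm (a' x)) 0.
  by rewrite mulr_ge0 ?l2norm_ge0.
rewrite -(ler_pM2l (x := l2norm (a' x))); last by rewrite lt_neqAle eq_sym a'x l2norm_ge0.
have -> : l2norm (a' x) * l2norm (a' x) = complex.Re (ip (a (a' x)) x).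
  by rewrite aa' ipxx /= -sqr_l2norm.
apply: le_trans (Re_ip_le _ _) _.
by rewrite mulrA ler_wpM2r ?l2norm_ge0// mulrC.
Qed.

Lemma bounded_sq a : bounded_op a ->
  exists2 M, 0 <= M & forall x, sqnorm (a x) <= M * sqnorm x.
Proof.
move=> [M M0 aM]; exists (M ^+ 2); first exact: sqr_ge0.
move=> x; rewrite -!sqr_l2norm -exprMn.
by rewrite ler_pXn2r// nnegrE ?mulr_ge0 ?l2norm_ge0.
Qed.

(* For a bounded operator k, this says that k is the norm limit of its
   compositions with the coordinate projections, i.e. that k is compact. *)
Definition compact_op (k : H -> H) := forall d : R, 0 < d ->
  exists N, forall x, (forall m, (m < N)%N -> x m = 0) ->
    sqnorm (k x) <= d * sqnorm x.

Lemma compact_op0 : compact_op (fun=> 0).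
Proof.
move=> d d0; exists 0%N => x _.
by rewrite -sqr_l2norm l2norm0 expr0n mulr_ge0 ?sqnorm_ge0 ?ltW.
Qed.

Lemma compact_op_approx k :
  (forall e : R, 0 < e -> exists2 k', compact_op k' &
    forall x, sqnorm (k x - k' x) <= e * sqnorm x) -> compact_op k.
Proof.
(* A quarter for each of the two terms, since [sqnormD_le] doubles their sum. *)
move=> kk d d0; have d4 : 0 < d / 4 by rewrite divr_gt0.
have [k' k'c kk'] := kk _ d4; have [N k'N] := k'c _ d4.
exists N => x xN; rewrite -(subrK (k' x) (k x)).
apply: le_trans (sqnormD_le _ _) _.
by have := kk' x; have := k'N x xN; lra.
Qed.

Lemma compact_opD k l : compact_op k -> compact_op l ->
  compact_op (fun x => k x + l x).
Proof.
move=> kc lc d d0; have d4 : 0 < d / 4 by rewrite divr_gt0.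
have [[N kN] [M lM]] := (kc _ d4, lc _ d4).
exists (maxn N M) => x xNM; apply: le_trans (sqnormD_le _ _) _.
have := kN x (fun m mN => xNM m (leq_trans mN (leq_maxl _ _))).
have := lM x (fun m mN => xNM m (leq_trans mN (leq_maxr _ _))).
by lra.
Qed.

Lemma compact_op_compl a k : bounded_op a -> compact_op k ->
  compact_op (fun x => a (k x)).
Proof.
move=> /bounded_sq[M M0 aM] kc d d0.
have M1 : 0 < M + 1 by rewrite ltr_wpDl.
have [N kN] := kc (d / (M + 1)) (divr_gt0 d0 M1).
exists N => x xN; apply: le_trans (aM _) _.
apply: (@le_trans _ _ ((M + 1) * sqnorm (k x))).
  by rewrite ler_wpM2r ?sqnorm_ge0 ?lerDl.
rewrite -ler_pdivlMl// mulrA [_^-1 * d]mulrC; exact: kN.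
Qed.

(* The first coordinates of a x are the numbers <x, a' e_m>; they are small when
   x vanishes far enough because a' e_m is square summable. *)
Lemma compact_op_compr a a' k k' :
  adjoint_pair a a' -> bounded_op a -> adjoint_pair k k' -> bounded_op k ->
  compact_op k -> compact_op (fun x => k (a x)).
Proof.
move=> aa' /bounded_sq[M M0 aM] kk' /bounded_sq[K K0 kK] kc d d0.
have M1 : 0 < 4 * (M + 1) by rewrite mulr_gt0// ltr_wpDl.
have K1 : 0 < 4 * (K + 1) by rewrite mulr_gt0// ltr_wpDl.
have [N0 kN0] := kc (d / (4 * (M + 1))) (divr_gt0 d0 M1).
(* Tolerance per coordinate: the first [N0] coordinates of [a x] together stay below d / (4 (K + 1))
   times [sqnorm x], so that applying [k], of squared bound [K], costs at most d / 4. The successor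
   keeps the divisor nonzero. *)
pose e := d / (4 * (K + 1)) / N0.+1%:R.
have e0 : 0 < e by rewrite !divr_gt0.
have /choice[n nP] : forall m, exists n,
    sqnorm (a' (l2basis R m) - trunc n (a' (l2basis R m))) <= e.
  by move=> m; exact: sqnorm_tail_small.
exists (\max_(m < N0) n m)%N => x xn.
have xP m y : (m < N0)%N -> ip x (trunc (n m) y) = 0.
  move=> mN0; apply: ip_unique.
  have -> : ipsum x (trunc (n m) y) = (fun=> 0).
    apply/funext => j; rewrite /ipsum big1// => i _; rewrite truncE.
    case: ifP => [inm|_]; last by rewrite conjc0 mulr0.
    rewrite xn ?mul0r//; apply: leq_trans inm _.
    exact: (leq_bigmax (Ordinal mN0)).
  exact: cvg_cst.
have head : sqsum (a x) N0 <= d / (4 * (K + 1)) * sqnorm x.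
  apply: (@le_trans _ _ (\sum_(m < N0) e * sqnorm x)).
    apply: ler_sum => m _; rewrite -(ip_basis (a x)) aa'.
    rewrite -(subrK (trunc (n m) (a' (l2basis R m))) (a' (l2basis R m))).
    rewrite ipDr xP// addr0; apply: le_trans (cauchy_schwarz _ _) _.
    by rewrite mulrC ler_wpM2r ?sqnorm_ge0.
  rewrite sumr_const card_ord -[leLHS]mulr_natl mulrA ler_wpM2r ?sqnorm_ge0//.
  rewrite /e mulrCA ler_piMr//; first by rewrite divr_ge0// ltW.
  by rewrite ler_pdivrMr// mul1r ler_nat.
have klin := adjoint_linear kk'.
have -> : a x = (a x - trunc N0 (a x)) + trunc N0 (a x) by rewrite subrK.
have -> : k (a x - trunc N0 (a x) + trunc N0 (a x)) =
    k (a x - trunc N0 (a x)) + k (trunc N0 (a x)).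
  by have := klin 1 (a x - trunc N0 (a x)) (trunc N0 (a x)); rewrite !scale1r.
apply: le_trans (sqnormD_le _ _) _.
have /kN0 : forall m, (m < N0)%N -> (a x - trunc N0 (a x)) m = 0.
  by move=> m mN0; rewrite l2B truncE mN0 subrr.
have h1 : d / (4 * (M + 1)) * sqnorm (a x - trunc N0 (a x)) <= d / 4 * sqnorm x.
  apply: (@le_trans _ _ (d / (4 * (M + 1)) * (M * sqnorm x))).
    apply: ler_wpM2l; first by rewrite divr_ge0// ltW.
    exact: le_trans (sqnorm_tail_le _ _) (aM x).
  rewrite mulrA ler_wpM2r ?sqnorm_ge0// invfM mulrA -[leLHS]mulrA ler_piMr//.
    by rewrite divr_ge0// ltW.
  by rewrite mulrC ler_pdivrMr ?ltr_wpDl// mul1r lerDl.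
have h2 : sqnorm (k (trunc N0 (a x))) <= d / 4 * sqnorm x.
  apply: le_trans (kK _) _.
  apply: (@le_trans _ _ (K * (d / (4 * (K + 1)) * sqnorm x))).
    by apply: ler_wpM2l => //; exact: le_trans (sqnorm_trunc _ _) head.
  rewrite mulrA [K * _]mulrC ler_wpM2r ?sqnorm_ge0// invfM mulrA -[leLHS]mulrA ler_piMr//.
    by rewrite divr_ge0// ltW.
  by rewrite mulrC ler_pdivrMr ?ltr_wpDl// mul1r lerDl.
by lra.
Qed.

End BasicOperators.

(** * The algebra of operators that commute with the shift modulo compact operators *)

Section ToeplitzPairs.
Context {R : realType}.
Local Notation C := (R[i]^o).
Local Notation H := (l2 R).
Implicit Types (x y z : H) (a b : H -> H).

Definition shift_comm a x := a (ushift x) - ushift (a x).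

(* This is weaker than membership in the C*-algebra generated by the shift, but
   passes to norm limits directly, so that no density argument is needed. *)
Definition toeplitz_pair a a' := [/\ adjoint_pair a a', bounded_op a,
  compact_op (shift_comm a) & compact_op (shift_comm a')].

Lemma toeplitz_pair_sym a a' : toeplitz_pair a a' -> toeplitz_pair a' a.
Proof.
move=> [aa' [M M0 aM] ac a'c]; split=> //; first exact: adjoint_sym.
by exists M => //; exact: adjoint_bound aa' M0 aM.
Qed.

Lemma shift_commD c a b : shift_comm (c *: a + b) = c *: shift_comm a + shift_comm b.
Proof.
apply/funext => x; rewrite /shift_comm.
change (c *: a (ushift x) + b (ushift x) - ushift (c *: a x + b x) =
  c *: (a (ushift x) - ushift (a x)) + (b (ushift x) - ushift (b x))).
by rewrite ushift_linear scalerBr opprD addrACA.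
Qed.

Lemma adjointD c a b a' b' : adjoint_pair a a' -> adjoint_pair b b' ->
  adjoint_pair (c *: a + b) (c^*%C *: a' + b').
Proof.
move=> aa' bb' x y; rewrite ipDl ipZl ipDr ipZr aa' bb'.
by rewrite conjc_invol.
Qed.

Lemma boundedD c a b : bounded_op a -> bounded_op b -> bounded_op (c *: a + b).
Proof.
move=> [M M0 aM] [N N0 bN]; exists (Num.sqrt (sqn c) * M + N).
  by rewrite addr_ge0 ?mulr_ge0 ?sqrtr_ge0.
move=> x; apply: le_trans (l2normD _ _) _; rewrite l2normZ mulrDl lerD//.
by rewrite -mulrA ler_wpM2l ?sqrtr_ge0.
Qed.

Lemma compact_opZ c k : compact_op k -> compact_op (fun x => c *: k x).
Proof.
apply: (@compact_op_compl _ (fun x => c *: x)).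
by exists (Num.sqrt (sqn c)); [exact: sqrtr_ge0|move=> x; rewrite l2normZ].
Qed.

Lemma toeplitz_pairD c a b a' b' : toeplitz_pair a a' -> toeplitz_pair b b' ->
  toeplitz_pair (c *: a + b) (c^*%C *: a' + b').
Proof.
move=> [aa' aM ac a'c] [bb' bM bc b'c]; split.
- exact: adjointD.
- exact: boundedD.
- by rewrite shift_commD; apply: compact_opD bc; exact: compact_opZ.
- by rewrite shift_commD; apply: compact_opD b'c; exact: compact_opZ.
Qed.

Lemma bounded_comp a b : bounded_op a -> bounded_op b -> bounded_op (a \o b).
Proof.
move=> [M M0 aM] [N N0 bN]; exists (M * N); first exact: mulr_ge0.
by move=> x; apply: le_trans (aM _) _; rewrite -mulrA ler_wpM2l.
Qed.

Lemma adjoint_comp a b a' b' : adjoint_pair a a' -> adjoint_pair b b' ->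
  adjoint_pair (a \o b) (b' \o a').
Proof. by move=> aa' bb' x y; rewrite aa' bb'. Qed.

Lemma ushift_bounded : bounded_op (@ushift R).
Proof. by exists 1 => // x; rewrite mul1r l2norm_ushift. Qed.

(** [compact_op_compr] asks for an adjoint of the compact operator; this provides it when that
    operator is a commutator with the shift. *)
Lemma shift_comm_adjoint a a' : adjoint_pair a a' ->
  adjoint_pair (shift_comm a) (fun x => unshift (a' x) - a' (unshift x)).
Proof.
by move=> aa' x y; rewrite ipBl ipBr aa' !ushift_adjoint aa'.
Qed.

Lemma shift_comm_bounded a : bounded_op a -> bounded_op (shift_comm a).
Proof.
move=> [M M0 aM]; exists (M + M); first exact: addr_ge0.
move=> x; apply: le_trans (l2normD _ _) _; rewrite mulrDl l2normN l2norm_ushift.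
by rewrite lerD// (le_trans (aM _))// l2norm_ushift.
Qed.

Lemma shift_comm_comp_compact a b a' b' :
  adjoint_pair a a' -> adjoint_pair b b' -> bounded_op a -> bounded_op b ->
  compact_op (shift_comm a) -> compact_op (shift_comm b) ->
  compact_op (shift_comm (a \o b)).
Proof.
move=> aa' bb' aM bM ac bc.
(* Leibniz rule [a b, v] = a [b, v] + [a, v] b; both terms are then compact by the ideal
   property. *)
have -> : shift_comm (a \o b) = fun x => a (shift_comm b x) + shift_comm a (b x).
  apply/funext => x; rewrite /shift_comm /=.
  have alin := adjoint_linear aa'.
  have -> : a (b (ushift x) - ushift (b x)) = a (b (ushift x)) - a (ushift (b x)).
    by rewrite [X in a X]addrC -[X in a (X + _)]scaleN1r alin scaleN1r addrC.
  by rewrite addrA subrK.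
apply: compact_opD; first exact: compact_op_compl.
apply: (compact_op_compr bb' bM (shift_comm_adjoint aa')) => //.
exact: shift_comm_bounded.
Qed.

Lemma toeplitz_pair_comp a b a' b' : toeplitz_pair a a' -> toeplitz_pair b b' ->
  toeplitz_pair (a \o b) (b' \o a').
Proof.
move=> pa pb; have [a'a a'M _ _] := toeplitz_pair_sym pa.
have [b'b b'M _ _] := toeplitz_pair_sym pb.
case: pa pb => [aa' aM ac a'c] [bb' bM bc b'c]; split.
- exact: adjoint_comp.
- exact: bounded_comp.
- exact: (shift_comm_comp_compact aa' bb').
- exact: (shift_comm_comp_compact b'b a'a).
Qed.

Lemma toeplitz_pair_id : toeplitz_pair id id.
Proof.
have c : compact_op (shift_comm id).
  rewrite (_ : shift_comm id = fun=> 0); first exact: compact_op0.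
  by apply/funext => x; rewrite /shift_comm subrr.
by split=> //; exists 1 => // x; rewrite mul1r.
Qed.

Lemma toeplitz_pair0 : toeplitz_pair 0 0.
Proof.
have c : compact_op (shift_comm 0).
  rewrite (_ : shift_comm 0 = fun=> 0); first exact: compact_op0.
  by apply/funext => x; rewrite /shift_comm ushift0 subr0.
split=> //; first by move=> x y; rewrite ip0l ip0r.
by exists 0 => // x; rewrite mul0r l2norm0.
Qed.

Lemma toeplitz_pair_shift : toeplitz_pair (@ushift R) (@unshift R).
Proof.
split.
- exact: ushift_adjoint.
- exact: ushift_bounded.
- rewrite (_ : shift_comm (@ushift R) = fun=> 0); first exact: compact_op0.
  by apply/funext => x; rewrite /shift_comm subrr.
(* For the adjoint of the shift the commutator is the projection onto the basis vector at 0, which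
   kills every [x] whose coordinate 0 vanishes. *)
- move=> d d0; exists 1%N => x x0; rewrite /shift_comm ushiftK unshiftK ?x0// subrr.
  by rewrite -[in leLHS]sqr_l2norm l2norm0 expr0n mulr_ge0 ?sqnorm_ge0 ?ltW.
Qed.

Definition toeplitz_op : {pred (H -> H)} :=
  fun a => `[< exists a', toeplitz_pair a a' >].

Fact toeplitz_op_submod_closed : submod_closed toeplitz_op.
Proof.
split; first by apply/asboolP; exists 0; exact: toeplitz_pair0.
move=> c a b /asboolP[a' pa] /asboolP[b' pb]; apply/asboolP.
by exists (c^*%C *: a' + b'); exact: toeplitz_pairD.
Qed.

HB.instance Definition _ := GRing.isSubmodClosed.Build R[i] (H -> H) toeplitz_op
  toeplitz_op_submod_closed.

End ToeplitzPairs.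

(** * The operators of Toeplitz type as a normed unital *-algebra *)

Section ToeplitzAlgebra.
Context (R : realType).
Local Notation C := (R[i]^o).
Local Notation H := (l2 R).

Record toep := Toep { toep_fun :> H -> H; toepP : toep_fun \in @toeplitz_op R }.

HB.instance Definition _ := [isSub for toep_fun].
HB.instance Definition _ := [Choice of toep by <:].
HB.instance Definition _ := [SubChoice_isSubLmodule of toep by <:].

Implicit Types (a b : toep) (x y z : H).

Lemma toep_eqP a b : (forall x, a x = b x) -> a = b.
Proof. by move=> ab; apply: val_inj; apply/funext. Qed.

Lemma toepD a b x : (a + b) x = a x + b x. Proof. by []. Qed.
Lemma toepZ c a x : (c *: a) x = c *: a x. Proof. by []. Qed.

Lemma toep_adj_ex a : exists a' : H -> H, toeplitz_pair a a'.
Proof. exact/asboolP/(toepP a). Qed.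

(** A chosen witness, yet without ambiguity: nondegeneracy of [ip] determines the adjoint, and
    [toep_star_eq] exploits this in the *-algebra laws. *)
Definition adj_fun a := sval (cid (toep_adj_ex a)).

Lemma adj_funP a : toeplitz_pair a (adj_fun a).
Proof. exact: (svalP (cid (toep_adj_ex a))). Qed.

Fact toep_star_subproof a : adj_fun a \in @toeplitz_op R.
Proof. by apply/asboolP; exists a; exact: toeplitz_pair_sym (adj_funP a). Qed.

Definition toep_star a : toep := Toep (toep_star_subproof a).

Fact toep_mul_subproof a b : (a \o b : H -> H) \in @toeplitz_op R.
Proof.
apply/asboolP; exists (adj_fun b \o adj_fun a).
exact: toeplitz_pair_comp (adj_funP a) (adj_funP b).
Qed.

Definition toep_mul a b : toep := Toep (toep_mul_subproof a b).

Lemma toep_adjP a x y : ip (a x) y = ip x (toep_star a y).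
Proof. by case: (adj_funP a). Qed.

Lemma toep_adjP' a x y : ip (toep_star a x) y = ip x (a y).
Proof. by rewrite ipC -toep_adjP -ipC. Qed.

Lemma toep_star_eq a b : (forall x y, ip (a x) y = ip x (b y)) -> toep_star a = b.
Proof.
move=> ab; apply: toep_eqP => x; apply: ip_inj => y.
by rewrite toep_adjP' ipC ab -ipC.
Qed.

Lemma toep_linear a : linear a.
Proof. by case: (adj_funP a) => + _ _ _; exact: adjoint_linear. Qed.

Lemma toep_opD a x y : a (x + y) = a x + a y.
Proof. by have := toep_linear a 1 x y; rewrite !scale1r. Qed.
Lemma toep_op0 a : a 0 = 0.
Proof. by apply: (addrI (a 0)); rewrite -toep_opD !addr0. Qed.
Lemma toep_opZ a c x : a (c *: x) = c *: a x.
Proof. by have := toep_linear a c x 0; rewrite toep_op0 !addr0. Qed.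
Fact toep_one_subproof : @id H \in @toeplitz_op R.
Proof. by apply/asboolP; exists id; exact: toeplitz_pair_id. Qed.

Definition toep_one : toep := Toep toep_one_subproof.

Fact toep_mulA : associative toep_mul.
Proof. by move=> a b c; apply: toep_eqP. Qed.
Fact toep_mulDl : left_distributive toep_mul +%R.
Proof.
by move=> a b c; apply: toep_eqP => x; rewrite [RHS]toepD; exact: (toepD a b (c x)).
Qed.
Fact toep_mulDr : right_distributive toep_mul +%R.
Proof.
by move=> a b c; apply: toep_eqP => x; rewrite [RHS]toepD; exact: (toep_opD a (b x) (c x)).
Qed.
Fact toep_mulZl (c : R[i]) a b : toep_mul (c *: a) b = c *: toep_mul a b.
Proof. exact: toep_eqP. Qed.
Fact toep_mulZr (c : R[i]) a b : toep_mul a (c *: b) = c *: toep_mul a b.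
Proof.
by apply: toep_eqP => x; rewrite [RHS]toepZ; exact: (toep_opZ a c (b x)).
Qed.
Fact toep_starK : involutive toep_star.
Proof. by move=> a; apply: toep_star_eq => x y; rewrite toep_adjP'. Qed.
Fact toep_starD a b : toep_star (a + b) = toep_star a + toep_star b.
Proof. by apply: toep_star_eq => x y; rewrite ipDl ipDr !toep_adjP. Qed.
Fact toep_starZ (c : R[i]) a : toep_star (c *: a) = c^*%C *: toep_star a.
Proof.
by apply: toep_star_eq => x y; rewrite ipZl ipZr toep_adjP conjc_invol.
Qed.
Fact toep_starM a b : toep_star (toep_mul a b) = toep_mul (toep_star b) (toep_star a).
Proof. by apply: toep_star_eq => x y; rewrite /= !toep_adjP. Qed.

HB.instance Definition _ := Lmodule_isStarAlgebra.Build R toep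
  toep_mulA toep_mulDl toep_mulDr toep_mulZl toep_mulZr
  toep_starK toep_starD toep_starZ toep_starM.

Fact toep_mul1l : left_id toep_one amul.
Proof. by move=> a; apply: toep_eqP. Qed.
Fact toep_mul1r : right_id toep_one amul.
Proof. by move=> a; apply: toep_eqP. Qed.

HB.instance Definition _ := StarAlgebra_isUnital.Build R toep
  toep_mul1l toep_mul1r.

Definition opnorm a : R := sup [set l2norm (a x) | x in [set x | l2norm x <= 1]].

Lemma opnorm_has_sup a : has_sup [set l2norm (a x) | x in [set x | l2norm x <= 1]].
Proof.
split; first by exists (l2norm (a 0)); exists 0 => //=; rewrite l2norm0.
have [_ [M M0 aM] _ _] := adj_funP a.
exists M => _ [x /= x1 <-]; apply: le_trans (aM x) _.
by rewrite -[leRHS]mulr1 ler_wpM2l.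
Qed.

Lemma opnorm_ge0 a : 0 <= opnorm a.
Proof.
apply: le_trans (l2norm_ge0 (a 0)) _; apply: sup_upper_bound (opnorm_has_sup a) _ _.
by exists 0 => //=; rewrite l2norm0.
Qed.

Lemma opnormP a x : l2norm (a x) <= opnorm a * l2norm x.
Proof.
have [x0|x0] := eqVneq (l2norm x) 0.
  have -> : x = 0 by apply: sqnorm_eq0; rewrite -sqr_l2norm x0 expr0n.
  by rewrite toep_op0 l2norm0 mulr0.
have {}x0 : 0 < l2norm x by rewrite lt_neqAle eq_sym x0 l2norm_ge0.
have cE : Num.sqrt (sqn ((l2norm x)^-1)%:C) = (l2norm x)^-1.
  by rewrite /sqn /= expr0n addr0 sqrtr_sqr ger0_norm ?invr_ge0 ?l2norm_ge0.
rewrite -ler_pdivrMr// mulrC -cE -l2normZ -toep_opZ.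
apply: sup_upper_bound (opnorm_has_sup a) _ _; exists (((l2norm x)^-1)%:C *: x) => //=.
by rewrite l2normZ cE mulVf ?gt_eqF.
Qed.

Lemma opnorm_le a M : 0 <= M -> (forall x, l2norm (a x) <= M * l2norm x) ->
  opnorm a <= M.
Proof.
move=> M0 aM; apply: ge_sup; first by case: (opnorm_has_sup a).
move=> _ [x /= x1 <-]; apply: le_trans (aM x) _.
by rewrite -[leRHS]mulr1 ler_wpM2l.
Qed.

Fact opnormD a b : (opnorm (a + b))%:C <= (opnorm a)%:C + (opnorm b)%:C.
Proof.
rewrite -rmorphD lecR; apply: opnorm_le => [|x]; first by rewrite addr_ge0 ?opnorm_ge0.
by apply: le_trans (l2normD _ _) _; rewrite mulrDl lerD ?opnormP.
Qed.

Lemma opnormZ_le (c : R[i]) a : opnorm (c *: a) <= Num.sqrt (sqn c) * opnorm a.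
Proof.
apply: opnorm_le => [|x]; first by rewrite mulr_ge0 ?sqrtr_ge0 ?opnorm_ge0.
by rewrite l2normZ -mulrA ler_wpM2l ?sqrtr_ge0 ?opnormP.
Qed.

Fact opnorm_eq0 a : (opnorm a)%:C = 0 -> a = 0.
Proof.
move=> /complexI a0; apply: toep_eqP => x; apply: sqnorm_eq0.
rewrite -sqr_l2norm; apply/eqP; rewrite sqrf_eq0 eq_le l2norm_ge0 andbT.
by apply: le_trans (opnormP a x) _; rewrite a0 mul0r.
Qed.

(** The upper bound [opnormZ_le], applied to the inverse scalar, yields the lower bound. *)
Fact opnormZ (c : R[i]) a : (opnorm (c *: a))%:C = `|c| * (opnorm a)%:C.
Proof.
rewrite sqn_norm -rmorphM; congr (_%:C); apply/eqP; rewrite eq_le opnormZ_le /=.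
have [->|c0] := eqVneq c 0; first by rewrite sqn0 sqrtr0 mul0r opnorm_ge0.
have sc0 : 0 < Num.sqrt (sqn c) by rewrite sqrtr_gt0 lt_neqAle eq_sym sqn_eq0 c0 sqn_ge0.
rewrite -ler_pdivlMl//.
have := opnormZ_le c^-1 (c *: a); rewrite scalerA mulVf// scale1r.
congr (_ <= _ * _); apply: complexI; rewrite -sqn_norm normfV sqn_norm.
by rewrite fmorphV.
Qed.

HB.instance Definition _ := Lmodule_isNormed.Build R[i] toep
  opnormD opnormZ opnorm_eq0.

Lemma toep_normE a : `|a| = (opnorm a)%:C. Proof. by []. Qed.

Lemma opnorm_mul a b : opnorm (amul a b) <= opnorm a * opnorm b.
Proof.
apply: opnorm_le => [|x]; first by rewrite mulr_ge0 ?opnorm_ge0.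
apply: (le_trans (opnormP a (b x))).
by rewrite -mulrA ler_wpM2l ?opnorm_ge0 ?opnormP.
Qed.

Lemma opnorm_star a : opnorm (star a) = opnorm a.
Proof.
have star_le c : opnorm (star c) <= opnorm c.
  apply: opnorm_le; first exact: opnorm_ge0.
  by apply: adjoint_bound (toep_adjP c) _ _; [exact: opnorm_ge0|exact: opnormP].
by apply/eqP; rewrite eq_le star_le -{1}(starK a) star_le.
Qed.

Lemma opnorm_cstar a : opnorm (amul (star a) a) = opnorm a ^+ 2.
Proof.
apply/eqP; rewrite eq_le; apply/andP; split.
  by rewrite expr2 -[X in _ <= X * _]opnorm_star opnorm_mul.
(* It remains to see that the square root of the norm of [amul (star a) a] bounds [a], which follows
   from |a x|^2 = Re <a* a x, x> and Cauchy-Schwarz. *)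
rewrite -[leRHS](sqr_sqrtr (opnorm_ge0 _)) ler_pXn2r// ?nnegrE ?sqrtr_ge0 ?opnorm_ge0//.
apply: opnorm_le => [|x]; first exact: sqrtr_ge0.
rewrite -(ler_pXn2r (n := 2))// ?nnegrE ?mulr_ge0 ?sqrtr_ge0 ?l2norm_ge0//.
rewrite exprMn (sqr_sqrtr (opnorm_ge0 _)) [leLHS]sqr_l2norm.
have -> : sqnorm (a x) = complex.Re (ip (amul (star a) a x) x).
  by rewrite toep_adjP' ipxx.
apply: le_trans (Re_ip_le _ _) _; rewrite expr2 mulrA.
by rewrite ler_wpM2r ?l2norm_ge0 ?opnormP.
Qed.

End ToeplitzAlgebra.

(** * Completeness in the operator norm, hence a C*-algebra *)

Section ToeplitzComplete.
Context {R : realType}.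
Local Notation C := (R[i]^o).
Local Notation H := (l2 R).
Implicit Types (x y z : H).

(** The limit is taken coordinate by coordinate, and the uniform estimate survives because it can be
    checked on finite partial sums. The limit is only a function here: the lemma serves both for a
    filter and for its image under [star], and the two limits are afterwards shown to be adjoint. *)
Lemma toep_limit (G : set_system (toep R)) : ProperFilter G ->
  (forall e : R, 0 < e -> exists a, G [set b | opnorm (a - b) <= e]) ->
  exists l : H -> H, forall (a : toep R) (e : R), G [set b | opnorm (a - b) <= e] ->
    forall x, sqnorm (l x - a x) <= e ^+ 2 * sqnorm x.
Proof.
move=> GG Gc.
have sqE (a b : toep R) (e : R) x : opnorm (a - b) <= e ->
    sqnorm (b x - a x) <= e ^+ 2 * sqnorm x.
  move=> abe; rewrite -sqnormN opprB -!sqr_l2norm -exprMn.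
  have e0 : 0 <= e by apply: le_trans abe; exact: opnorm_ge0.
  rewrite ler_pXn2r// ?nnegrE ?mulr_ge0 ?l2norm_ge0//.
  by apply: le_trans (opnormP (a - b) x) _; rewrite ler_wpM2r ?l2norm_ge0.
have coordc x i : cvg ((fun b : toep R => b x i : C) @ G).
  apply: complex_complete; apply: cauchy_exP => e e0.
  have eE : e = (complex.Re e)%:C.
    by move: e0; case: e => a b; rewrite ltcE /= => /andP[/eqP-> _].
  have {}e0 : 0 < complex.Re e by rewrite -ltcR -eE.
  have x1 : 0 < l2norm x + 1 by rewrite ltr_wpDl ?l2norm_ge0.
  have [a Ga] := Gc (complex.Re e / (l2norm x + 1)) (divr_gt0 e0 x1).
  exists (a x i); rewrite /fmap /=; apply: filterS Ga => b /= abe.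
  rewrite /ball /= eE [ltLHS]sqn_norm ltcR.
  apply: (@le_lt_trans _ _ (l2norm ((a - b) x))).
    by rewrite ler_wsqrtr// (sqn_coord_le ((a - b) x)).
  apply: le_lt_trans (opnormP _ _) _.
  apply: (@le_lt_trans _ _ (complex.Re e / (l2norm x + 1) * l2norm x)).
    by rewrite ler_wpM2r ?l2norm_ge0.
  by rewrite mulrAC ltr_pdivrMr// ltr_pM2l// ltrDl.
pose f x i : C := lim ((fun b : toep R => b x i : C) @ G).
have fle (a : toep R) (e : R) x n : G [set b | opnorm (a - b) <= e] ->
    sqsum (fun i => f x i - a x i : C) n <= e ^+ 2 * sqnorm x.
  move=> Ga.
  have lcvg : (fun b : toep R => sqsum (b x - a x) n) @ G --> sqsum (fun i => f x i - a x i : C) n.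
    elim: n => [|n IHn].
      rewrite /sqsum big_ord0 (_ : (fun b => _) = fun=> 0); first exact: cvg_cst.
      by apply/funext => b; rewrite big_ord0.
    have recr (u : nat -> C) : sqsum u n.+1 = sqsum u n + sqn (u n).
      by rewrite /sqsum big_ord_recr.
    rewrite recr (_ : (fun b => _) =
        (fun b : toep R => sqsum (b x - a x) n + sqn (b x n - a x n))).
      apply: cvgD IHn _; apply: (continuous_cvg _ (@sqn_continuous R _)).
      exact: (cvgB (coordc x n) (cvg_cst _)).
    by apply/funext => b; rewrite recr.
  rewrite -(cvg_lim (@norm_hausdorff _ _) lcvg); apply: limr_le.
    by apply: cvgP lcvg.
  by apply: filterS Ga => b ab; exact: le_trans (sqsum_le (b x - a x) n) (sqE a b e x ab).
have fl2 x : f x \in sqsummable (R := R).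
  have [a /fle Ga] := Gc 1 ltr01.
  have -> : f x = (fun i => f x i - a x i : C) + a x.
    by apply/funext => i; rewrite -[RHS]/(f x i - a x i + a x i) subrK.
  by apply: rpredD (l2valP (a x)); apply/asboolP; eexists => n; exact: Ga.
exists (fun x => L2 (fl2 x)) => a e Ga x.
by apply: sqnorm_le => n; exact: fle.
Qed.

Lemma toep_complete (F : set_system (toep R)) :
  ProperFilter F -> cauchy F -> cvg F.
Proof.
move=> FF /cauchyP Fc0.
have Fc (e : R) : 0 < e -> exists a, F [set b | opnorm (a - b) <= e].
  move=> e0; have [a Fa] := Fc0 e%:C ltac:(by rewrite ltcR).
  exists a; apply: filterS Fa => b; rewrite -ball_normE /= toep_normE ltcR.
  exact: ltW.
have [l lP] := toep_limit FF Fc.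
have starB (a b : toep R) : opnorm (star a - star b) = opnorm (a - b).
  by rewrite -starN -starD opnorm_star.
have starFc (e : R) : 0 < e ->
    exists a, (star b @[b --> F]) [set b | opnorm (a - b) <= e].
  move=> /Fc[a Fa]; exists (star a); change (F [set b | opnorm (star a - star b) <= e]).
  by apply: filterS Fa => b ab; rewrite /mkset starB.
have [l' l'P] := toep_limit (fmap_proper_filter _ FF) starFc.
have approx (d : R) : 0 < d -> exists a : toep R,
    (forall x, sqnorm (l x - a x) <= d * sqnorm x) /\
    (forall x, sqnorm (l' x - star a x) <= d * sqnorm x).
  move=> d0; have s0 : 0 < Num.sqrt d by rewrite sqrtr_gt0.
  have [a Fa] := Fc _ s0; exists a; rewrite -(sqr_sqrtr (ltW d0)); split.
    exact: lP.
  apply: l'P; change (F [set b | opnorm (star a - star b) <= Num.sqrt d]).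
  by apply: filterS Fa => b ab; rewrite /mkset starB.
(* Adjointness passes to the limit: replacing [l] and [l'] by a common approximant [a] and [star a]
   changes both inner products by amounts that Cauchy-Schwarz makes arbitrarily small. *)
have ll' : adjoint_pair l l'.
  move=> x z; apply/eqP; rewrite -subr_eq0 -sqn_eq0 eq_le sqn_ge0 andbT.
  apply/ler_addgt0Pr => e e0; rewrite add0r.
  pose c := sqnorm x * sqnorm z.
  have c0 : 0 <= c by rewrite mulr_ge0 ?sqnorm_ge0.
  have c1 : 0 < 4 * (c + 1) by rewrite mulr_gt0// ltr_wpDl.
  have [a [la l'a]] := approx (e / (4 * (c + 1))) (divr_gt0 e0 c1).
  have -> : ip (l x) z - ip x (l' z) =
      ip (l x - a x) z - ip x (l' z - star a z).
    by rewrite ipBl ipBr toep_adjP opprB addrA subrK.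
  apply: le_trans (sqnD_le _ _) _.
  have sqnN w : sqn (- w) = sqn w :> R by case: w => u v; rewrite /sqn /= !sqrrN.
  have h1 : sqn (ip (l x - a x) z) <= e / (4 * (c + 1)) * c.
    apply: le_trans (cauchy_schwarz _ _) _.
    by rewrite /c mulrA ler_wpM2r ?sqnorm_ge0.
  have h2 : sqn (ip x (l' z - star a z)) <= e / (4 * (c + 1)) * c.
    apply: le_trans (cauchy_schwarz _ _) _.
    by rewrite /c mulrCA ler_wpM2l ?sqnorm_ge0.
  rewrite sqnN; apply: (@le_trans _ _ (4 * (e / (4 * (c + 1)) * c))); first by lra.
  have -> : 4 * (e / (4 * (c + 1)) * c) = e * c / (c + 1).
    by field; rewrite gt_eqF// ltr_wpDl.
  by rewrite ler_pdivrMr ?ltr_wpDl// ler_wpM2l ?lerDl ?ltW.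
have lbd : bounded_op l.
  have [a [la _]] := approx 1 ltr01; exists (1 + opnorm a).
    by rewrite addr_ge0 ?opnorm_ge0.
  move=> x; rewrite -(subrK (a x) (l x)); apply: le_trans (l2normD _ _) _.
  rewrite mulrDl mul1r; apply: lerD; last exact: opnormP.
  by apply: ler_wsqrtr; apply: le_trans (la x) _; rewrite mul1r.
(* The shift is isometric, so the commutator of [k] is a norm limit of the compact commutators of
   its approximants. *)
have compact_lim (k : H -> H) : (forall d : R, 0 < d -> exists a : toep R,
    forall x, sqnorm (k x - a x) <= d * sqnorm x) -> compact_op (shift_comm k).
  move=> ka; apply: compact_op_approx => e e0.
  have [|a kae] := ka (e / 4); first exact: divr_gt0.
  exists (shift_comm a); first by case: (adj_funP a).
  move=> x; have -> : shift_comm k x - shift_comm a x =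
      (k (ushift x) - a (ushift x)) - ushift (k x - a x).
    rewrite /shift_comm ushiftB !opprB addrACA [RHS]addrACA.
    by congr (_ + _); rewrite addrC.
  apply: le_trans (sqnormD_le _ _) _; rewrite sqnormN sqnorm_ushift.
  by have := kae (ushift x); rewrite sqnorm_ushift; have := kae x; lra.
have ltoep : l \in @toeplitz_op R.
  apply/asboolP; exists l'; split => //; apply: compact_lim => d /approx[a [la l'a]].
    by exists a.
  by exists (star a).
apply/cvg_ex; exists (Toep ltoep); apply/fcvg_ballP => e e0.
have eE : e = (complex.Re e)%:C.
  by move: e0; case: e => a b; rewrite ltcE /= => /andP[/eqP-> _].
have {}e0 : 0 < complex.Re e by rewrite -ltcR -eE.
have [a Fa] := Fc (complex.Re e / 4) (divr_gt0 e0 (ltr0Sn _ 3)).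
have la : opnorm (Toep ltoep - a) <= complex.Re e / 4.
  have e4 : 0 <= complex.Re e / 4 by rewrite divr_ge0// ltW.
  apply: opnorm_le => // x.
  rewrite -(ler_pXn2r (n := 2)) ?nnegrE ?l2norm_ge0 ?(mulr_ge0 e4) ?l2norm_ge0//.
  by rewrite exprMn !sqr_l2norm; exact: lP.
apply: (@filterS _ F _ _ _ _ Fa) => b ab.
rewrite -ball_normE /ball_ /mkset toep_normE eE ltcR.
have := opnormD (Toep ltoep - a) (a - b); rewrite -rmorphD lecR addrA subrK.
move=> /le_lt_trans; apply; apply: le_lt_trans (lerD la ab) _.
by move: (complex.Re e) e0 => r r0; lra.
Qed.

HB.instance Definition _ := Uniform_isComplete.Build (toep R) toep_complete.

Fact toep_norm_mul_le (a b : toep R) : `|amul a b| <= `|a| * `|b|.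
Proof. by rewrite !toep_normE -rmorphM lecR opnorm_mul. Qed.

Fact toep_norm_cstar (a : toep R) : `|amul (star a) a| = `|a| ^+ 2.
Proof. by rewrite !toep_normE opnorm_cstar rmorphXn. Qed.

HB.instance Definition _ := StarAlgebra_isCStar.Build R (toep R)
  toep_norm_mul_le toep_norm_cstar.

End ToeplitzComplete.

(** * The gauge-equivariant representation *)

Section Phase.
Context {R : realType} (w : R[i]).
Hypothesis w1 : w * w^*%C = 1.
Local Notation C := (R[i]^o).
Local Notation H := (l2 R).
Implicit Types (x y z : H).

Let sqnw : sqn w = 1.
Proof. by apply: complexI; rewrite sqnE w1. Qed.

Fact sqn_phase (x : nat -> C) i : sqn (w ^+ i * x i) = sqn (x i).
Proof.
rewrite sqnM; have -> : sqn (w ^+ i) = 1; last by rewrite mul1r.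
elim: i => [|i IHi]; last by rewrite exprS sqnM IHi sqnw mul1r.
by rewrite expr0 /sqn /= expr0n addr0 expr1n.
Qed.

Fact phase_subproof x : (fun i => w ^+ i * x i : C) \in sqsummable (R := R).
Proof.
apply/asboolP; exists (sqnorm x) => n; apply: le_trans (sqsum_le x n).
by apply: ler_sum => i _; rewrite sqn_phase.
Qed.

(** The diagonal unitary with entries w^i. Conjugation by it multiplies the shift by [w], so it
    implements the gauge action on l^2(N). *)
Definition phase x : H := L2 (phase_subproof x).

Lemma phaseE x i : phase x i = w ^+ i * x i. Proof. by []. Qed.

Lemma sqnorm_phase x : sqnorm (phase x) = sqnorm x.
Proof.
rewrite /sqnorm (_ : sqsum (phase x) = sqsum x)//.
by apply/funext => n; apply: eq_bigr => i _; exact: sqn_phase.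
Qed.

Lemma phase_ushift x : phase (ushift x) = w *: ushift (phase x).
Proof.
apply/l2P => -[|i]; first by rewrite phaseE l2Z ushiftE0 !mulr0.
by rewrite phaseE l2Z !ushiftES phaseE exprS mulrA.
Qed.

Lemma phase_linear : linear phase.
Proof.
by move=> c x y; apply/l2P => i; rewrite phaseE !l2D !l2Z !phaseE; ring.
Qed.

Lemma phaseD x y : phase (x + y) = phase x + phase y.
Proof. by have := phase_linear 1 x y; rewrite !scale1r. Qed.
Lemma phaseZ c x : phase (c *: x) = c *: phase x.
Proof. by apply/l2P => i; rewrite phaseE !l2Z phaseE mulrCA. Qed.
Lemma phaseB x y : phase (x - y) = phase x - phase y.
Proof. by rewrite -scaleN1r phaseD phaseZ scaleN1r. Qed.

Lemma phase_bounded : bounded_op phase.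
Proof. by exists 1 => // x; rewrite mul1r /l2norm sqnorm_phase. Qed.

Lemma phase_basis m : phase (l2basis R m) = w ^+ m *: l2basis R m.
Proof.
apply/l2P => i; rewrite phaseE l2Z l2basisE.
by case: eqP => [->//|_]; rewrite !mulr0.
Qed.

End Phase.

Section PhaseConjugation.
Context {R : realType} (w : R[i]).
Hypothesis w1 : w * w^*%C = 1.
Local Notation H := (l2 R).
Implicit Types (x y z : H).

Fact conj_unimodular : w^*%C * w^*%C^*%C = 1.
Proof. by rewrite conjc_invol mulrC. Qed.

Local Notation u := (phase w1).
Local Notation v := (phase conj_unimodular).

Let wX i : w ^+ i * w^*%C ^+ i = 1.
Proof. by rewrite -exprMn w1 expr1n. Qed.

Lemma phaseK : cancel v u.
Proof. by move=> x; apply/l2P => i; rewrite !phaseE mulrA wX mul1r. Qed.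

Lemma phaseVK : cancel u v.
Proof. by move=> x; apply/l2P => i; rewrite !phaseE mulrA [_ * w ^+ _]mulrC wX mul1r. Qed.

Lemma phase_adjoint : adjoint_pair u v.
Proof.
move=> x y; apply: ip_unique.
have -> : ipsum (u x) y = ipsum x (v y).
  apply/funext => n; apply: eq_bigr => i _; rewrite !phaseE conjcM.
  rewrite mulrCA mulrA; congr (_ * _ * _).
  by elim: (nat_of_ord i) => [|j IHj]; rewrite ?expr0 ?conjc1// !exprS conjcM conjc_invol IHj.
exact: ipsum_cvg.
Qed.

Lemma compact_op_phase k : compact_op k -> compact_op (fun x => k (v x)).
Proof.
move=> kc d d0; have [N kN] := kc d d0; exists N => x xN.
rewrite -(sqnorm_phase conj_unimodular x); apply: kN => m mN.
by rewrite phaseE xN// mulr0.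
Qed.

Fact conj_phase_toeplitz a a' : toeplitz_pair a a' ->
  toeplitz_pair (u \o a \o v) (u \o a' \o v).
Proof.
have cc b : linear b -> compact_op (shift_comm b) ->
    compact_op (shift_comm (u \o b \o v)).
  move=> bl bc.
  have bZ c x : b (c *: x) = c *: b x.
    have b0 : b 0 = 0 by apply: (addrI (b 0)); have := bl 1 0 0; rewrite !scale1r !addr0.
    by have := bl c x 0; rewrite b0 !addr0.
  (* Moving the shift through either phase costs the same factor, the conjugate of [w]; hence the
     commutator is the conjugated commutator of [b] up to that scalar. *)
  have -> : shift_comm (u \o b \o v) =
      fun x => w^*%C *: u (shift_comm b (v x)).
    apply/funext => x; rewrite /shift_comm /comp phase_ushift bZ phaseZ phaseB.
    by rewrite scalerBr phase_ushift scalerA [_ * w]mulrC w1 scale1r.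
  apply: compact_opZ; apply: compact_op_compl (phase_bounded w1) _.
  exact: compact_op_phase.
move=> pa; have [a'a _ _ _] := toeplitz_pair_sym pa.
case: pa => aa' aM ac a'c; split.
- apply: (adjoint_comp (adjoint_comp phase_adjoint aa')).
  exact: adjoint_sym phase_adjoint.
- by apply: bounded_comp (phase_bounded _); apply: bounded_comp aM; exact: phase_bounded.
- by apply: cc => //; exact: adjoint_linear aa'.
- by apply: cc => //; exact: adjoint_linear a'a.
Qed.

Fact conj_phase_subproof (a : toep R) : (u \o a \o v : H -> H) \in @toeplitz_op R.
Proof.
by apply/asboolP; exists (u \o adj_fun a \o v); exact: conj_phase_toeplitz (adj_funP a).
Qed.

Definition conj_phase (a : toep R) : toep R := Toep (conj_phase_subproof a).

Lemma conj_phaseE a x : conj_phase a (phase w1 x) = phase w1 (a x).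
Proof. by rewrite -[LHS]/(u (a (v (u x)))) phaseVK. Qed.

Lemma conj_phase_star_hom : is_star_hom conj_phase.
Proof.
split=> [c a b|a b|a].
- apply: toep_eqP => x; exact: phase_linear.
- by apply: toep_eqP => x; rewrite -[RHS]/(u (a (v (u (b (v x)))))) phaseVK.
- apply/esym; apply: toep_star_eq => x y.
  rewrite -[ip _ _]/(ip (u (a (v x))) y) -[RHS]/(ip x (u (star a (v y)))).
  by rewrite phase_adjoint toep_adjP (adjoint_sym phase_adjoint).
Qed.

End PhaseConjugation.

Section ToeplitzRepresentation.
Context {R : realType}.

Fact toep_shift_subproof : @ushift R \in @toeplitz_op R.
Proof. by apply/asboolP; exists (@unshift R); exact: toeplitz_pair_shift. Qed.

Definition toep_shift : toep R := Toep toep_shift_subproof.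

Lemma toep_shift_isometry : amul (star toep_shift) toep_shift = aone.
Proof.
apply: toep_eqP => x; apply: ip_inj => y.
by rewrite -[LHS]/(ip (star toep_shift (toep_shift x)) y) toep_adjP' ip_ushift ushiftK.
Qed.

Lemma star_homD (A B : starAlgType R) (f : A -> B) : is_star_hom f ->
  {morph f : a b / a + b}.
Proof. by move=> [fl _ _] a b; have := fl 1 a b; rewrite !scale1r. Qed.

Lemma star_homZ (A B : starAlgType R) (f : A -> B) c a : is_star_hom f ->
  f (c *: a) = c *: f a.
Proof.
move=> fh; have f0 : f 0 = 0.
  by apply: (addrI (f 0)); rewrite -(star_homD fh) !addr0.
by have [fl _ _] := fh; have := fl c a 0; rewrite f0 !addr0.
Qed.

Lemma star_hom_comp (A B D : starAlgType R) (f : A -> B) (g : B -> D) :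
  is_star_hom f -> is_star_hom g -> is_star_hom (g \o f).
Proof.
move=> [fl fM fs] [gl gM gs]; split=> [c a b|a b|a] /=.
- by rewrite fl gl.
- by rewrite fM gM.
- by rewrite fs gs.
Qed.

Lemma circle_unimodular (z : circle R) : circle_val z * (circle_val z)^*%C = 1.
Proof. by rewrite -sqr_normc circle_valP expr1n. Qed.

(** The action [gamma] is known on generators only. Equivariance follows from the uniqueness in
    [toeplitz_universal]: both composites are unital *-homomorphisms sending the isometry to [w]
    times the shift. *)
Lemma toeplitz_representation (T : unitalCStarAlgType R)
    (P : vertex toeplitz_graph -> T) (S : edge toeplitz_graph -> T)
    (gamma : gaction (circle R) T) :
  is_graph_algebra P S -> is_gauge_action P S gamma ->
  exists psi : T -> toep R, [/\ is_star_hom psi, psi aone = aone &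
    forall z a, psi (gamma z a) = conj_phase (circle_unimodular z) (psi a)].
Proof.
move=> TG gg.
have [psi [[psih psi1 psiV] _]] := toeplitz_universal TG toep_shift_isometry.
exists psi; split=> // z a.
pose w := circle_val z; pose W : toep R := w *: toep_shift.
have WW : amul (star W) W = aone.
  rewrite /W starZ amulZl amulZr toep_shift_isometry scalerA.
  by rewrite [_ * w]mulrC circle_unimodular scale1r.
have [f [_ fu]] := toeplitz_universal TG WW.
have ghom := gact_star_hom gamma z.
rewrite -[LHS]/((psi \o gamma z) a) -(fu (psi \o gamma z)).
  rewrite -[RHS]/((conj_phase (circle_unimodular z) \o psi) a).
  rewrite -(fu (conj_phase (circle_unimodular z) \o psi))//; split.
  - exact: star_hom_comp psih (conj_phase_star_hom _).
  - by rewrite /= psi1; apply: toep_eqP => x; exact: phaseK.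
  - rewrite /= psiV; apply: toep_eqP => x.
    rewrite -[LHS]/(phase _ (ushift (phase _ x))) -[RHS]/(w *: ushift x).
    have -> : w *: ushift x = w *: ushift (phase (circle_unimodular z)
      (phase (conj_unimodular (circle_unimodular z)) x)) by rewrite phaseK.
    by rewrite -phase_ushift.
split.
- exact: star_hom_comp ghom psih.
(* [is_star_hom] says nothing of the unit; it is preserved as the sum of the two vertex projections,
   which the gauge action fixes. *)
- rewrite -[LHS]/(psi (gamma z aone)) -{1}(toeplitz_unit TG) (star_homD ghom).
  by rewrite !(gg z).1 (toeplitz_unit TG).
- rewrite -[LHS]/(psi (gamma z _)) (star_homD ghom) !(gg z).2 -scalerDr.
  by rewrite (star_homZ _ _ psih) psiV.
Qed.

End ToeplitzRepresentation.

(** * The index obstruction *)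

(** More unknowns than equations: the rank is at most [#|T|], so the left kernel is nonzero.
    Solutions are extended by zero off [S], so that later sums run over the whole type. *)
Lemma homogeneous_system (K : fieldType) (X : finType) (S T : {set X})
    (M : X -> X -> K) : (#|T| < #|S|)%N ->
  exists c : X -> K, [/\ exists s, c s != 0, forall s, s \notin S -> c s = 0 &
    forall t, t \in T -> \sum_s c s * M s t = 0].
Proof.
move=> TS; pose A := \matrix_(i < #|S|, j < #|T|) M (enum_val i) (enum_val j).
have kA : kermx A != 0.
  by rewrite -mxrank_eq0 mxrank_ker subn_eq0 -ltnNge (leq_ltn_trans (rank_leq_col A)).
have /rowV0Pn[v /sub_kermxP vA v0] := kA.
pose c s := \sum_(i < #|S|) v 0 i * (enum_val i == s)%:R.
have cE i : c (enum_val i) = v 0 i.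
  rewrite /c (bigD1 i)//= eqxx mulr1 big1 ?addr0// => j ji.
  by rewrite (inj_eq enum_val_inj) (negbTE ji) mulr0.
have cS s : s \notin S -> c s = 0.
  move=> sS; rewrite /c big1// => i _; case: eqP => [is_|_]; last by rewrite mulr0.
  by case/negP: sS; rewrite -is_ enum_valP.
exists c; split=> //.
  have [i vi] : exists i, v 0 i != 0.
    apply/existsP; apply: contraNT v0; rewrite negb_exists => /forallP v0.
    by apply/eqP/rowP => i; rewrite mxE; apply/eqP; rewrite -[_ == _]negbK.
  by exists (enum_val i); rewrite cE.
move=> t tT; rewrite (bigID (mem S))/= addrC big1 ?add0r; last first.
  by move=> s /cS ->; rewrite mul0r.
rewrite big_enum_val/=.
transitivity ((v *m A) 0 (enum_rank_in tT t)); last by rewrite vA mxE.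
rewrite mxE; apply: eq_bigr => i _; rewrite cE mxE.
by rewrite enum_rankK_in.
Qed.

(** * Finite families of square-summable sequences *)

Section Vectors.
Context {R : realType} {I : finType}.
Local Notation H := (l2 R).
Local Notation HI := (I -> H).
Implicit Types x y z : HI.

Definition ipI x y : R[i] := \sum_i ip (x i) (y i).
Definition sqnormI x : R := \sum_i sqnorm (x i).
Definition ushiftI x : HI := fun i => ushift (x i).
Definition basisI m j : HI := fun i => if i == j then l2basis R m else 0.

Lemma ipIxx x : ipI x x = (sqnormI x)%:C.
Proof. by rewrite rmorph_sum; apply: eq_bigr => i _; exact: ipxx. Qed.

Lemma sqnormI_ge0 x : 0 <= sqnormI x.
Proof. by apply: sumr_ge0 => i _; exact: sqnorm_ge0. Qed.

Lemma sqnormI_eq0 x : sqnormI x = 0 -> x = 0.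
Proof.
move=> /eqP; rewrite psumr_eq0 => [/allP x0|i _]; last exact: sqnorm_ge0.
apply/funext => i; apply: sqnorm_eq0; apply/eqP.
by have := x0 i (mem_index_enum _).
Qed.

Lemma ipIDl x y z : ipI (x + y) z = ipI x z + ipI y z.
Proof. by rewrite -big_split; apply: eq_bigr => i _; exact: ipDl. Qed.

Lemma ipIZl c x y : ipI (c *: x) y = c * ipI x y.
Proof. by rewrite mulr_sumr; apply: eq_bigr => i _; exact: ipZl. Qed.

Lemma ipI0l y : ipI 0 y = 0.
Proof. by rewrite /ipI big1// => i _; exact: ip0l. Qed.

Lemma ipI_suml (J : finType) (F : J -> HI) y :
  ipI (\sum_j F j) y = \sum_j ipI (F j) y.
Proof. exact: (big_morph (ipI^~ y) (fun a b => ipIDl a b y) (ipI0l y)). Qed.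

Lemma sqnormIB x y :
  sqnormI (x - y) = sqnormI x + sqnormI y - 2 * complex.Re (ipI x y).
Proof.
have ReE : complex.Re (ipI x y) = \sum_i complex.Re (ip (x i) (y i)).
  by apply: (big_morph (@complex.Re R)) => // -[a b] [c d].
rewrite ReE mulr_sumr -big_split -sumrB; apply: eq_bigr => i _ /=.
rewrite -[(x - y) i]/(x i - y i) sqnormD sqnormN ipNr.
by case: (ip _ _) => a b /=; rewrite mulrN.
Qed.

Lemma sqnormI_ushift x : sqnormI (ushiftI x) = sqnormI x.
Proof. by apply: eq_bigr => i _; exact: sqnorm_ushift. Qed.

Lemma ipI_ushift x y : ipI (ushiftI x) (ushiftI y) = ipI x y.
Proof. by apply: eq_bigr => i _; rewrite ip_ushift ushiftK. Qed.

Lemma ipI_basis x m j : ipI x (basisI m j) = x j m.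
Proof.
rewrite /ipI (bigD1 j)//= /basisI eqxx ip_basis big1 ?addr0// => i /negbTE ->.
exact: ip0r.
Qed.

Lemma sumI_coord (J : finType) (F : J -> HI) i m :
  (\sum_j F j) i m = \sum_j F j i m.
Proof.
by apply: (big_morph (fun x : HI => x i m : R[i])).
Qed.

End Vectors.

Section IndexObstruction.
Context {R : realType} {I : finType} (w : R[i]) (w1 : w * w^*%C = 1).
(* dc and dr are the degrees of the columns and of the rows of b. *)
Context (b : I -> I -> toep R) (dc dr : I -> nat).
Local Notation H := (l2 R).
Local Notation HI := (I -> H).
Local Notation u := (phase w1).
Implicit Types x y z : HI.

Hypothesis b_isometry : forall j j',
  \sum_i amul (star (b i j)) (b i j') = (j == j')%:R *: aone.
Hypothesis b_coisometry : forall i i',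
  \sum_j amul (b i j) (star (b i' j)) = (i == i')%:R *: aone.
Hypothesis b_graded : forall i j (x : H),
  w ^+ dr i *: u (b i j x) = w ^+ dc j *: b i j (u x).
Hypothesis b_star_graded : forall i j (x : H),
  w ^+ dc j *: u (star (b i j) x) = w ^+ dr i *: star (b i j) (u x).

Let U x : HI := fun i => \sum_j b i j (x j).
Let Us x : HI := fun j => \sum_i star (b i j) (x i).

Let toep_sum (J : finType) (F : J -> toep R) (x : H) : (\sum_j F j) x = \sum_j F j x.
Proof. exact: (big_morph (fun a : toep R => a x)). Qed.

Let toep_op_sum (J : finType) (a : toep R) (F : J -> H) : a (\sum_j F j) = \sum_j a (F j).
Proof. exact: (big_morph a (toep_opD a) (toep_op0 a)). Qed.

Let UsU x : Us (U x) = x.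
Proof.
apply/funext => j; rewrite /Us /U.
under eq_bigr do rewrite toep_op_sum.
rewrite exchange_big (bigD1 j)//= [X in _ + X]big1 ?addr0 => [|j' j'j].
  transitivity ((\sum_i amul (star (b i j)) (b i j)) (x j)); first exact/esym/toep_sum.
  by rewrite b_isometry eqxx scale1r.
transitivity ((\sum_i amul (star (b i j)) (b i j')) (x j')); first exact/esym/toep_sum.
by rewrite b_isometry eq_sym (negbTE j'j) scale0r.
Qed.

Let UUs x : U (Us x) = x.
Proof.
apply/funext => j; rewrite /Us /U.
under eq_bigr do rewrite toep_op_sum.
rewrite exchange_big (bigD1 j)//= [X in _ + X]big1 ?addr0 => [|j' j'j].
  transitivity ((\sum_i amul (b j i) (star (b j i))) (x j)); first exact/esym/toep_sum.
  by rewrite b_coisometry eqxx scale1r.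
transitivity ((\sum_i amul (b j i) (star (b j' i))) (x j')); first exact/esym/toep_sum.
by rewrite b_coisometry eq_sym (negbTE j'j) scale0r.
Qed.

Let U_adj x y : ipI (Us x) y = ipI x (U y).
Proof.
rewrite /ipI /Us /U; under eq_bigr do rewrite ip_suml.
under [RHS]eq_bigr do rewrite ip_sumr.
rewrite exchange_big; apply: eq_bigr => i _; apply: eq_bigr => j _.
exact: toep_adjP'.
Qed.

Let ip_UU x y : ipI (U x) (U y) = ipI x y.
Proof. by rewrite -U_adj UsU. Qed.

Let U_sqnorm x : sqnormI (U x) = sqnormI x.
Proof. by apply: complexI; rewrite -!ipIxx ip_UU. Qed.

Let UD x y : U (x + y) = U x + U y.
Proof.
apply/funext => i; rewrite -[RHS]/(U x i + U y i) -big_split.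
by apply: eq_bigr => j _; exact: toep_opD.
Qed.

Let U0 : U 0 = 0.
Proof. by apply/funext => i; rewrite /U big1// => j _; exact: toep_op0. Qed.

Let UZ c x : U (c *: x) = c *: U x.
Proof.
apply/funext => i; rewrite -[RHS]/(c *: U x i) scaler_sumr.
by apply: eq_bigr => j _; exact: toep_opZ.
Qed.

Let sqnorm_sum (r : seq I) (F : I -> H) :
  sqnorm (\sum_(i <- r) F i) <= 2 ^+ size r * \sum_(i <- r) sqnorm (F i).
Proof.
elim: r => [|i r IHr].
  by rewrite !big_nil mulr0 -sqr_l2norm l2norm0 expr0n.
rewrite !big_cons; apply: le_trans (sqnormD_le _ _) _.
have s0 : 0 <= \sum_(j <- r) sqnorm (F j) by apply: sumr_ge0 => j _; exact: sqnorm_ge0.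
rewrite /= exprS -mulrA ler_wpM2l// mulrDr; apply: lerD IHr.
by rewrite ler_peMl ?sqnorm_ge0// exprn_ege1// ler1n.
Qed.

(** The matrix has finitely many entries, each commuting with the shift up to a compact operator, so
    one [N] serves them all. The factor 2 could be any constant above 1; it makes the final estimate
    of the index argument contradictory. *)
Let U_almost_commutes : exists N, forall z, (forall i m, (m < N)%N -> z i m = 0) ->
  2 * sqnormI (U (ushiftI z) - ushiftI (U z)) <= sqnormI z.
Proof.
(* [K] collects the losses: 2^n from [sqnorm_sum] over a row, [#|I|] rows, and the factor 2 of the
   statement; the successor keeps it positive when [I] is empty. *)
pose n := size (index_enum I); pose K : R := 2 * (2 ^+ n * #|I|.+1%:R).
have K0 : 0 < K by rewrite !mulr_gt0// exprn_gt0.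
have /choice[N NP] : forall p : I * I, exists N, forall x : H,
    (forall m, (m < N)%N -> x m = 0) ->
    sqnorm (shift_comm (b p.1 p.2) x) <= K^-1 * sqnorm x.
  move=> p; case: (adj_funP (b p.1 p.2)) => _ _ + _; apply.
  by rewrite invr_gt0.
exists (\max_p N p)%N => z zN.
have DE i : (U (ushiftI z) - ushiftI (U z)) i = \sum_j shift_comm (b i j) (z j).
  have ushift_sum (F : I -> H) : ushift (\sum_j F j) = \sum_j ushift (F j).
    exact: (big_morph (@ushift R) (@ushiftD R) (@ushift0 R)).
  rewrite -[LHS]/(\sum_j b i j (ushift (z j)) - ushift (\sum_j b i j (z j))).
  by rewrite ushift_sum -sumrB.
have D_le i : sqnorm ((U (ushiftI z) - ushiftI (U z)) i) <=
    2 ^+ n * (K^-1 * sqnormI z).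
  rewrite DE; apply: le_trans (sqnorm_sum _ _) _.
  rewrite ler_wpM2l ?exprn_ge0// /sqnormI mulr_sumr; apply: ler_sum => j _.
  apply: (NP (i, j)) => m mN; apply: zN; apply: leq_trans mN _.
  exact: (leq_bigmax (i, j)).
apply: (@le_trans _ _ (2 * \sum_(i : I) 2 ^+ n * (K^-1 * sqnormI z))).
  by rewrite ler_wpM2l//; apply: ler_sum => i _; exact: D_le.
rewrite sumr_const -[X in 2 * X]mulr_natr.
have -> : 2 * (2 ^+ n * (K^-1 * sqnormI z) * #|I|%:R) =
    K^-1 * (2 * (2 ^+ n * #|I|%:R)) * sqnormI z by ring.
rewrite ler_piMl ?sqnormI_ge0// mulrC ler_pdivrMr// mul1r /K.
by rewrite !ler_wpM2l ?exprn_ge0// ler_nat.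
Qed.

(** Degree as an eigenvalue: coordinate m of [x i] may be nonzero only if w^(d i + m) = zeta.
    Integer degrees that [w] does not separate are thereby identified. *)
Let graded (d : I -> nat) (zeta : R[i]) x :=
  forall i, w ^+ d i *: u (x i) = zeta *: x i.

Let phase_sum (J : finType) (F : J -> H) : u (\sum_j F j) = \sum_j u (F j).
Proof.
apply: (big_morph u (phaseD w1)).
by apply/l2P => i; rewrite phaseE mulr0.
Qed.

(** The offset [r], later 1, makes room for the degree that the shift adds after [U]. *)
Let U_graded r zeta x : graded (fun j => dc j + r)%N zeta x ->
  graded (fun i => dr i + r)%N zeta (U x).
Proof.
move=> xg i; rewrite /U phase_sum !scaler_sumr; apply: eq_bigr => j _.
rewrite addnC exprD -scalerA b_graded scalerA -exprD addnC.
by rewrite -!toep_opZ xg.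
Qed.

Let Us_graded zeta x : graded dr zeta x -> graded dc zeta (Us x).
Proof.
move=> xg j; rewrite /Us phase_sum !scaler_sumr; apply: eq_bigr => i _.
by rewrite b_star_graded -!toep_opZ xg.
Qed.

Let gradedD d zeta x y : graded d zeta x -> graded d zeta y -> graded d zeta (x + y).
Proof.
move=> xg yg i; rewrite -[(x + y) i]/(x i + y i).
by rewrite phaseD !scalerDr xg yg.
Qed.

Let graded_sum (J : finType) (F : J -> HI) d zeta :
  (forall j, graded d zeta (F j)) -> graded d zeta (\sum_j F j).
Proof.
move=> Fg; apply: (big_ind (graded d zeta)) => //; last by move=> x y; exact: gradedD.
move=> i; apply/l2P => m.
by rewrite !l2Z phaseE /= !mulr0.
Qed.

Let gradedZ_basis d zeta c m j : (w ^+ (d j + m) != zeta -> c = 0) ->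
  graded d zeta (c *: basisI m j).
Proof.
move=> cz i; rewrite -[(_ *: _) i]/(c *: basisI m j i) /basisI.
case: eqP => [->|_]; last first.
  by apply/l2P => l; rewrite !l2Z phaseE !l2Z /= !mulr0.
rewrite phaseZ phase_basis !scalerA [_ * c]mulrC -[c * _ * _]mulrA -exprD [zeta * c]mulrC.
have [->//|/cz ->] := eqVneq (w ^+ (d j + m)) zeta.
by rewrite !mul0r.
Qed.

(* Choose N such that |U v z - v U z|^2 <= |z|^2 / 2 when z vanishes below N, v
   being the shift. If there were too many rows of degree zeta, counting unknowns
   would give a nonzero x = v U Y + Z of degree zeta, with Y supported below N and
   Z in the cokernel of v, orthogonal to U y for all y supported on [0, N]. Then
   U^* x = v z' with z' vanishing below N, and x is orthogonal to v U z', so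
   |x|^2 <= |x - v U z'|^2 = |U v z' - v U z'|^2 <= |z'|^2 / 2 = |x|^2 / 2. *)
Lemma graded_index_le (zeta : R[i]) :
  (#|[set i | w ^+ dr i == zeta]%SET| <= #|[set j | w ^+ dc j == zeta]%SET|)%N.
Proof.
rewrite leqNgt; apply/negP => odd_gt; have [N comm] := U_almost_commutes.
(* Unknowns [S]: coefficients of Y (left) and of Z (right). Equations [T]: orthogonality to U
   e_(m+1) (left) and to U e_0 (right). Since v U e_m and U e_(m+1) have the same degree, dc + 1 +
   m, the left parts coincide, and [S] exceeds [T] exactly by the excess of rows over columns of
   degree zeta. *)
pose S := [set s : 'I_N * I + I | match s with
  | inl p => w ^+ (dc p.2 + 1 + p.1) == zeta | inr i => w ^+ dr i == zeta end]%SET.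
pose T := [set s : 'I_N * I + I | match s with
  | inl p => w ^+ (dc p.2 + 1 + p.1) == zeta | inr j => w ^+ dc j == zeta end]%SET.
have TS : (#|T| < #|S|)%N.
  have cardE (d : I -> nat) (A : pred ('I_N * I)) :
      #|[set s : 'I_N * I + I | match s with
         | inl p => A p | inr i => w ^+ d i == zeta end]%SET| =
      (#|[set p | A p]%SET| + #|[set i | w ^+ d i == zeta]%SET|)%N.
    by rewrite -!sum1dep_card big_sumType.
  rewrite (cardE dc (fun p => w ^+ (dc p.2 + 1 + p.1) == zeta)).
  by rewrite (cardE dr (fun p => w ^+ (dc p.2 + 1 + p.1) == zeta)) ltn_add2l.
pose xS (s : 'I_N * I + I) : HI := match s with
  | inl p => ushiftI (U (basisI p.1 p.2)) | inr i => basisI 0 i end.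
pose xT (s : 'I_N * I + I) : HI := match s with
  | inl p => basisI p.1.+1 p.2 | inr j => basisI 0 j end.
have [c [[s0 cs0] cS cT]] :=
  homogeneous_system (fun s t => ipI (xS s) (U (xT t))) TS.
pose Y : HI := \sum_p c (inl p) *: basisI p.1 p.2.
pose Z : HI := \sum_i c (inr i) *: basisI 0 i.
pose x : HI := ushiftI (U Y) + Z.
have xE : x = \sum_s c s *: xS s.
  rewrite big_sumType /=; congr (_ + _).
  have VUD : {morph (fun y => ushiftI (U y)) : y z / y + z}.
    by move=> y z; apply/funext => i; rewrite /ushiftI UD; exact: ushiftD.
  have VU0 : ushiftI (U 0) = 0.
    by rewrite U0; apply/funext => i; exact: ushift0.
  rewrite /Y (big_morph _ VUD VU0); apply: eq_bigr => p _.
  by rewrite UZ; apply/funext => i; exact: ushiftZ.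
have basisE m j i l : basisI m j i l = ((i == j) && (l == m))%:R :> R[i].
  by rewrite /basisI; case: eqP.
have YE j (m : 'I_N) : Y j m = c (inl (m, j)).
  rewrite sumI_coord (bigD1 (m, j))//= big1 ?addr0.
    by rewrite -[LHS]/(_ * basisI m j j m) basisE !eqxx mulr1.
  move=> [m' j']; rewrite xpair_eqE negb_and => mj.
  rewrite -[LHS]/(_ * basisI m' j' j m) basisE.
  rewrite [j == _]eq_sym [nat_of_ord m == _]eq_sym (inj_eq val_inj) andbC.
  by rewrite (negbTE (_ : ~~ ((m' == m) && (j' == j)))) ?mulr0// negb_and.
have ZE i : Z i 0%N = c (inr i).
  rewrite sumI_coord (bigD1 i)//= big1 ?addr0.
    by rewrite -[LHS]/(_ * basisI 0 i i 0%N) basisE !eqxx mulr1.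
  move=> j ji; rewrite -[LHS]/(_ * basisI 0 j i 0%N) basisE.
  by rewrite eq_sym (negbTE ji) mulr0.
(* Coordinate 0 sees only Z, because shifted vectors vanish there; once Z = 0, the isometry v U
   recovers Y. *)
have x_neq0 : x <> 0.
  move=> x0; have cr i : c (inr i) = 0.
    by rewrite -ZE -[Z i 0%N]add0r -[LHS]/(x i 0%N) x0.
  have Z0 : Z = 0 by rewrite /Z big1// => i _; rewrite cr scale0r.
  have Y0 : Y = 0.
    apply: sqnormI_eq0; rewrite -U_sqnorm -sqnormI_ushift.
    have -> : ushiftI (U Y) = 0 by move: x0; rewrite /x Z0 addr0.
    by apply: complexI; rewrite -ipIxx ipI0l.
  case: s0 cs0 => [[m j]|i]; last by rewrite cr eqxx.
  by rewrite -YE Y0 eqxx.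
have x_graded : graded dr zeta x.
  apply: gradedD; last first.
    apply: graded_sum => i; apply: gradedZ_basis; rewrite addn0 => iz.
    by apply: cS; rewrite inE.
  have : graded (fun i => dr i + 1)%N zeta (U Y).
    apply: U_graded; apply: graded_sum => -[m j].
    by apply: gradedZ_basis => mz; apply: cS; rewrite inE.
  move=> UYg i; rewrite /ushiftI phase_ushift scalerA -exprSr -addn1.
  by rewrite -ushiftZ UYg ushiftZ.
pose z := Us x.
have z_graded : graded dc zeta z by exact: Us_graded.
(* The bound includes m = N, because undoing the shift lowers indices by one. Coordinates of degree
   other than zeta vanish since [z] is homogeneous; the remaining ones vanish by the equations in
   [T]. *)
have zN j m : (m <= N)%N -> z j m = 0.
  move=> mN; have [mz|mz] := eqVneq (w ^+ (dc j + m)) zeta; last first.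
    have := congr1 (fun y : H => y m : R[i]) (z_graded j).
    rewrite !l2Z phaseE mulrA -exprD => /eqP; rewrite -subr_eq0 -mulrBl mulf_eq0.
    by rewrite subr_eq0 (negbTE mz) /= => /eqP.
  have zt t : t \in T -> ipI x (U (xT t)) = 0.
    move=> /cT ct; rewrite xE ipI_suml -[RHS]ct; apply: eq_bigr => s _.
    exact: ipIZl.
  rewrite -ipI_basis U_adj; case: m mN mz => [_|m mN] mz.
    by apply: (zt (inr j)); rewrite inE -mz addn0.
  by apply: (zt (inl (Ordinal mN, j))); rewrite inE -mz /= -addnA add1n.
pose z' : HI := fun j => unshift (z j).
have zz' : z = ushiftI z'.
  by apply/funext => j; rewrite /ushiftI unshiftK// zN.
have z'N j m : (m < N)%N -> z' j m = 0 by move=> mN; rewrite unshiftE zN.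
have := comm z' z'N.
have -> : U (ushiftI z') = x by rewrite -zz' UUs.
have -> : sqnormI z' = sqnormI x by rewrite -sqnormI_ushift -zz' -U_sqnorm UUs.
rewrite sqnormIB.
(* Z is orthogonal to the range of the shift, and <v U Y, v U z'> = <Y, z'> vanishes because Y lives
   below [N] and [z'] from [N] on. *)
have -> : ipI x (ushiftI (U z')) = 0.
  rewrite /x ipIDl ipI_ushift ip_UU /Z /Y !ipI_suml !big1 ?addr0// => [i|[m j]] _.
    rewrite ipIZl; have -> : ipI (basisI 0 i) (ushiftI (U z')) = 0; last by rewrite mulr0.
    rewrite /ipI big1// => j _; rewrite /basisI; case: eqP => _; last exact: ip0l.
    by rewrite ipC ip_basis conjc0.
  rewrite ipIZl; have -> : ipI (basisI m j) z' = 0; last by rewrite mulr0.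
  rewrite /ipI big1// => l _; rewrite /basisI; case: eqP => _; last exact: ip0l.
  by rewrite ipC ip_basis z'N ?conjc0.
have : 0 < sqnormI x.
  rewrite lt_neqAle sqnormI_ge0 andbT eq_sym; apply/eqP => /sqnormI_eq0.
  exact: x_neq0.
have := sqnormI_ge0 (ushiftI (U z')).
by rewrite /= mulr0 subr0; lra.
Qed.

(** The matrix is square, so row counts and column counts have the same total [#|I|]; inequality in
    every degree therefore forces equality of the two multisets of values. *)
Lemma graded_index_eq : \sum_i w ^+ dr i = \sum_j w ^+ dc j.
Proof.
pose so := [seq w ^+ dr i | i <- enum I]; pose se := [seq w ^+ dc i | i <- enum I].
have countE (d : I -> nat) (a : R[i]) :
    count_mem a [seq w ^+ d i | i <- enum I] = #|[set i | w ^+ d i == a]%SET|.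
  rewrite count_map -sum1_count big_enum_cond -sum1_card.
  by apply: eq_bigl => i; rewrite inE.
have [s' s'e so'] : exists2 s, subseq s se & perm_eq so s.
  by apply/count_subseqP => a; rewrite !countE; exact: graded_index_le.
have /eqP s'E : s' == se.
  by rewrite -(size_subseq_leqif s'e) -(perm_size so') !size_map.
have sumE (d : I -> nat) : \sum_i w ^+ d i = \sum_(a <- [seq w ^+ d i | i <- enum I]) a.
  by rewrite big_map big_enum.
by rewrite !sumE; apply: perm_big; rewrite -/se -s'E.
Qed.

End IndexObstruction.

(** * A graded unitary on E_nG *)

Section JoinFunctions.
Local Open Scope quotient_scope.
Context {R : realType} {X Y : topologicalType}.
Local Notation C := (R[i]^o).
Local Notation unit_interval := (unit_interval R).

Lemma join_lift (F : X * Y * unit_interval -> C) : continuous F ->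
  (forall p q, join_rel p q -> F p = F q) ->
  exists f : cfun R (join R X Y), forall x y t, f (join_pi x y t) = F (x, y, t).
Proof.
move=> Fc Frel.
pose f (c : join R X Y) : C :=
  F (generic_quotient.repr (c : {eq_quot join_equiv R X Y})).
have fE p : f (\pi_({eq_quot join_equiv R X Y}) p) = F p.
  by apply: Frel; apply/eqmodP; rewrite reprK.
have fc : continuous f.
  apply/quotient_continuous.
  by have -> : f \o \pi_({eq_quot join_equiv R X Y}) = F by apply/funext.
by exists (mkcts fc) => x y t; exact: fE.
Qed.

(** Weights with squares summing to 1: [join_s] vanishes at t = 1, where X is collapsed, and
    [join_c] at t = 0, where Y is, so that weighted functions of one factor descend to the join. *)
Definition join_s (t : unit_interval) : R[i] := (Num.sqrt (1 - set_val t))%:C.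
Definition join_c (t : unit_interval) : R[i] := (Num.sqrt (set_val t))%:C.

Lemma join_s2c2 t : join_s t * join_s t + join_c t * join_c t = 1.
Proof.
have /andP[t0 t1] : 0 <= set_val t <= 1 by have := set_mem (valP t); rewrite /= in_itv.
rewrite /join_s /join_c -!rmorphM -rmorphD /= -!expr2 !sqr_sqrtr ?subr_ge0//.
by rewrite subrK.
Qed.

Lemma unit_interval_val_continuous : continuous (set_val : unit_interval -> R).
Proof. exact: initial_continuous. Qed.

Lemma join_s_continuous : continuous (join_s : unit_interval -> C).
Proof.
move=> t.
have st : (1 - set_val s : R) @[s --> t] --> (1 - set_val t : R).
  exact: (cvgB (cvg_cst _) (@unit_interval_val_continuous t)).
exact: (continuous_cvg _ (@real_complex_continuous R _)
  (continuous_cvg _ (@sqrt_continuous R _) st)).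
Qed.

Lemma join_c_continuous : continuous (join_c : unit_interval -> C).
Proof.
move=> t; exact: (continuous_cvg _ (@real_complex_continuous R _)
  (continuous_cvg _ (@sqrt_continuous R _) (@unit_interval_val_continuous t))).
Qed.

Lemma join_lift_l (f : cfun R X) :
  exists g : cfun R (join R X Y), forall x y t, g (join_pi x y t) = join_s t * f x.
Proof.
apply: (@join_lift (fun p => join_s p.2 * f p.1.1)) => [p|p q].
  apply: cvgM.
    exact: (continuous_comp cvg_snd (@join_s_continuous p.2)).
  apply: (@continuous_comp _ _ _ (fun q : X * Y * unit_interval => q.1.1) f).
    exact: (continuous_comp cvg_fst cvg_fst).
  exact: cts_fun.
move=> /and3P[/eqP pq /orP[/eqP t1|/eqP ->] _]; last by rewrite pq.
by rewrite /join_s -pq t1 subrr sqrtr0 !mul0r.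
Qed.

Lemma join_lift_r (f : cfun R Y) :
  exists g : cfun R (join R X Y), forall x y t, g (join_pi x y t) = join_c t * f y.
Proof.
apply: (@join_lift (fun p => join_c p.2 * f p.1.2)) => [p|p q].
  apply: cvgM.
    exact: (continuous_comp cvg_snd (@join_c_continuous p.2)).
  apply: (@continuous_comp _ _ _ (fun q : X * Y * unit_interval => q.1.2) f).
    exact: (continuous_comp cvg_fst cvg_snd).
  exact: cts_fun.
move=> /and3P[/eqP pq _ /orP[/eqP t1|/eqP ->]]; last by rewrite pq.
by rewrite /join_c -pq t1 sqrtr0 !mul0r.
Qed.

End JoinFunctions.

Section JoinUnitary.
Context {R : realType} {I : finType} (W : I -> I -> R[i]) (s c z : R[i]).
Hypotheses (s_real : s^*%C = s) (c_real : c^*%C = c).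
Hypotheses (z1 : z * z^*%C = 1) (sc1 : s * s + c * c = 1).

(* The 2 x 2 block matrix [[s W, - c z], [c z^*, s W^*]]: on a join it represents
   the product of the class of W with the class of z. *)
Definition join_unitary (a b : I + I) : R[i] := match a, b with
  | inl i, inl j => s * W i j
  | inl i, inr i' => - ((i == i')%:R * (c * z))
  | inr j, inl j' => (j == j')%:R * (c * z^*%C)
  | inr j, inr i => s * (W i j)^*%C
  end.

Hypothesis W_isometry : forall j j', \sum_i (W i j)^*%C * W i j' = (j == j')%:R.
Hypothesis W_coisometry : forall i i', \sum_j W i j * (W i' j)^*%C = (i == i')%:R.

Let conj_nat (n : nat) : (n%:R : R[i])^*%C = n%:R. Proof. exact: conjc_nat. Qed.

Let sum_only (F : I -> R[i]) i : (forall k, k != i -> F k = 0) -> \sum_k F k = F i.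
Proof. by move=> F0; rewrite (bigD1 i)//= big1 ?addr0. Qed.

Let conjE := (@conjcM R, @conjcN R, @conjc_invol R, conj_nat, s_real, c_real).

Let diag (d : R[i]) : s * s * d + c * c * (z * z^*%C) * d = d.
Proof. by rewrite z1 mulr1 -mulrDl sc1 mul1r. Qed.

(** Scalars commute, so the two mixed contributions, both s c z times a conjugate entry of [W],
    cancel. The second block of columns is orthonormal by the coisometry relation of [W], hence both
    relations travel through the induction. *)
Lemma join_unitary_isometry a b :
  \sum_k (join_unitary k a)^*%C * join_unitary k b = (a == b)%:R.
Proof.
rewrite big_sumType; case: a b => [j|i] [j'|i'] /=.
- rewrite [X in _ + X](sum_only (i := j)) => [|k /negbTE kj]; last by rewrite kj !conjE !mul0r.
  rewrite eqxx (_ : \sum_i _ = s * s * (j == j')%:R); last first.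
    rewrite -W_isometry mulr_sumr; apply: eq_bigr => i _; rewrite !conjE; ring.
  rewrite !conjE -[inl j == _]/(j == j') -[RHS]diag /=; ring.
- rewrite [X in X + _](sum_only (i := i')) => [|k /negbTE ki]; last by rewrite ki mul0r oppr0 mulr0.
  rewrite [X in _ + X](sum_only (i := j)) => [|k /negbTE kj]; last by rewrite kj !conjE !mul0r.
  by rewrite !eqxx !conjE /=; ring.
- rewrite [X in X + _](sum_only (i := i)) => [|k /negbTE ki]; last first.
    by rewrite ki !conjE mul0r oppr0 mul0r.
  rewrite [X in _ + X](sum_only (i := j')) => [|k /negbTE kj]; last by rewrite kj mul0r mulr0.
  by rewrite !eqxx !conjE /=; ring.
- rewrite [X in X + _](sum_only (i := i)) => [|k /negbTE ki]; last first.
    by rewrite ki !conjE mul0r oppr0 mul0r.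
  rewrite eqxx (_ : \sum_k (s * (W i k)^*)^*%C * _ = s * s * (i == i')%:R); last first.
    rewrite -W_coisometry mulr_sumr; apply: eq_bigr => k _; rewrite !conjE; ring.
  rewrite !conjE -[inr i == _]/(i == i') -[RHS]diag /=; ring.
Qed.

Lemma join_unitary_coisometry a b :
  \sum_k join_unitary a k * (join_unitary b k)^*%C = (a == b)%:R.
Proof.
rewrite big_sumType; case: a b => [i|j] [i'|j'] /=.
- rewrite [X in _ + X](sum_only (i := i)) => [|k]; last first.
    by rewrite eq_sym => /negbTE ->; rewrite mul0r oppr0 mul0r.
  rewrite eqxx (_ : \sum_j _ = s * s * (i == i')%:R); last first.
    rewrite -W_coisometry mulr_sumr; apply: eq_bigr => k _; rewrite !conjE; ring.
  rewrite !conjE [i' == i]eq_sym -[inl i == _]/(i == i') -[RHS]diag /=; ring.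
- rewrite [X in X + _](sum_only (i := j')) => [|k]; last first.
    by rewrite eq_sym => /negbTE ->; rewrite !conjE mul0r mulr0.
  rewrite [X in _ + X](sum_only (i := i)) => [|k]; last first.
    by rewrite eq_sym => /negbTE ->; rewrite mul0r oppr0 mul0r.
  by rewrite !eqxx !conjE /=; ring.
- rewrite [X in X + _](sum_only (i := j)) => [|k]; last first.
    by rewrite eq_sym => /negbTE ->; rewrite !mul0r.
  rewrite [X in _ + X](sum_only (i := i')) => [|k]; last first.
    by rewrite eq_sym => /negbTE ->; rewrite !conjE mul0r oppr0 mulr0.
  by rewrite !eqxx !conjE /=; ring.
- rewrite [X in X + _](sum_only (i := j)) => [|k]; last first.
    by rewrite eq_sym => /negbTE ->; rewrite !mul0r.
  rewrite eqxx (_ : \sum_k s * _ * _ = s * s * (j == j')%:R); last first.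
    rewrite -W_isometry mulr_sumr; apply: eq_bigr => k _; rewrite !conjE; ring.
  rewrite !conjE [j' == j]eq_sym -[inr j == _]/(j == j') -[RHS]diag /=; ring.
Qed.

End JoinUnitary.

Section GradedUnitary.
Context {R : realType} {G : topGroupType} (chi : G -> circle R).
Hypothesis chiM : {morph chi : x y / (x * y)%g}.
Hypothesis chi_continuous : continuous chi.
Local Notation C := (R[i]^o).

(** The last clause says that entry (i, j) is multiplied by the power dc j - dr i of the character,
    written without negative exponents. *)
Definition graded_unitary (X : gspace G) (I : finType) (dc dr : I -> nat)
    (W : I -> I -> cfun R X) :=
  [/\ forall x j j', \sum_i (W i j x)^*%C * W i j' x = (j == j')%:R,
      forall x i i', \sum_j W i j x * (W i' j x)^*%C = (i == i')%:R &
      forall g x i j, circle_val (chi g) ^+ dr i * W i j (gtrans x g) =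
        circle_val (chi g) ^+ dc j * W i j x].

Let chi1 g : circle_val (chi g) * (circle_val (chi g))^*%C = 1.
Proof. exact: circle_unimodular. Qed.

Let chi_c : continuous (fun g => circle_val (chi g) : C).
Proof.
move=> g; apply: (@continuous_comp _ _ _ chi (@circle_val R : _ -> C)).
  exact: chi_continuous.
exact: circle_val_continuous.
Qed.

Let chif : cfun R G := mkcts chi_c.

(** Conjugation inverts a unimodular scalar, so the adjoint entry has row and column degrees
    exchanged. *)
Lemma conjc_graded (z u v : R[i]) (m n : nat) : z * z^*%C = 1 ->
  z ^+ m * u = z ^+ n * v -> z ^+ n * u^*%C = z ^+ m * v^*%C.
Proof.
move=> z1 uv; have zX l : z ^+ l * (z^*%C) ^+ l = 1 by rewrite -exprMn z1 expr1n.
have conjX l : (z ^+ l)^*%C = (z^*%C) ^+ l.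
  by elim: l => [|l IHl]; rewrite ?expr0 ?conjc1// !exprS conjcM IHl.
have := congr1 (fun a => z ^+ m * z ^+ n * a^*%C) uv.
rewrite !conjcM !conjX => uv'.
have -> : z ^+ n * u^*%C = z ^+ m * z ^+ n * (z^*%C ^+ m * u^*%C).
  by rewrite -[LHS]mul1r -(zX m); ring.
by rewrite uv' -[RHS]mul1r -(zX n); ring.
Qed.

Lemma graded_unitary_EG n : exists (I : finType) (dc dr : I -> nat)
    (W : I -> I -> cfun R (EG R G n)), graded_unitary dc dr W /\
  forall w : R[i], \sum_j w ^+ dc j - \sum_i w ^+ dr i = (1 - w) ^+ n.+1.
Proof.
elim: n => [|n [I [dc [dr [W [[Wi Wc Wg] Ws]]]]]].
  (* One row and one column: chi(g) times the conjugate of chi(x g) is the conjugate of chi(x), so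
     the row has degree 1, the column degree 0, and the graded dimension is 1 - w. *)
  exists unit, (fun=> 0%N), (fun=> 1%N), (fun _ _ => cfun_conj chif); split; last first.
    by move=> w; rewrite !big_const !card_unit /= !addr0.
  split.
  - by move=> x [] []; rewrite big_const card_unit /= addr0 conjc_invol ?eqxx chi1.
  - by move=> x [] []; rewrite big_const card_unit /= addr0 conjc_invol ?eqxx mulrC chi1.
  - move=> g x _ _; rewrite expr1 expr0 mul1r.
    rewrite -[LHS]/(circle_val (chi g) * (circle_val (chi (x * g)%g))^*%C).
    by rewrite chiM circle_valM conjcM mulrCA chi1 mulr1.
have /choice[Wl WlE] : forall p : I * I, exists f : cfun R (EG R G n.+1),
    forall x y t, f (join_pi x y t) = join_s t * W p.1 p.2 x.
  by move=> p; exact: join_lift_l.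
have [chir chirE] := @join_lift_r R (EG R G n) G chif.
pose W' (a b : I + I) : cfun R (EG R G n.+1) := match a, b with
  | inl i, inl j => Wl (i, j)
  | inl i, inr i' => if i == i' then - chir else 0
  | inr j, inl j' => if j == j' then cfun_conj chir else 0
  | inr j, inr i => cfun_conj (Wl (i, j))
  end.
(* The adjoint block swaps rows with columns, and the entries in [z] force a degree shift by one:
   the new dimension is (dc + w dr) - (dr + w dc), which is (1 - w) times the old one. *)
pose dc' (a : I + I) := match a with inl j => dc j | inr i => (dr i).+1 end.
pose dr' (a : I + I) := match a with inl i => dr i | inr j => (dc j).+1 end.
exists (I + I)%type, dc', dr', W'; split; last first.
  move=> w; rewrite !big_sumType /=; under [X in _ + X - _]eq_bigr do rewrite exprS.
  under [X in _ - (_ + X)]eq_bigr do rewrite exprS.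
  by rewrite -!mulr_sumr exprS -Ws; ring.
have sconj t : (@join_s R t)^*%C = join_s t by exact: conjc_real.
have cconj t : (@join_c R t)^*%C = join_c t by exact: conjc_real.
pose V (x : EG R G n) (y : G) t :=
  join_unitary (fun i j => W i j x) (join_s t) (join_c t) (circle_val (chi y)).
have W'E x y t a b : W' a b (join_pi x y t) = V x y t a b.
  case: a b => [i|j] [j'|i'] /=.
  - exact: WlE.
  - case: eqP => _; last by rewrite mul0r oppr0.
    by rewrite -[LHS]/(- chir _) chirE mul1r.
  - case: eqP => _; last by rewrite mul0r.
    by rewrite -[LHS]/((chir _)^*%C) chirE mul1r conjcM cconj.
  - by rewrite -[LHS]/((Wl _ _)^*%C) WlE conjcM sconj.
split.
- elim/joinW => x y t a b; under eq_bigr do rewrite !W'E.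
  exact: (join_unitary_isometry (sconj t) (cconj t) (chi1 y) (join_s2c2 t)).
- elim/joinW => x y t a b; under eq_bigr do rewrite !W'E.
  exact: (join_unitary_coisometry (sconj t) (cconj t) (chi1 y) (join_s2c2 t)).
- move=> g; elim/joinW => x y t a b.
  rewrite -[gtrans _ _]/(join_map _ _ _) join_mapE !W'E.
  case: a b => [i|j] [j'|i'] /=.
  - by rewrite mulrCA Wg mulrCA.
  - have [->|_] := eqVneq i i'; last by rewrite !mul0r !oppr0 !mulr0.
    rewrite chiM circle_valM exprS; ring.
  - have [->|_] := eqVneq j j'; last by rewrite !mul0r !mulr0.
    rewrite chiM circle_valM conjcM exprS.
    have := chi1 g; set z := circle_val _ => z1.
    by rewrite -[in RHS](mul1r (z ^+ _ * _)) -z1; ring.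
  - rewrite !exprS -!mulrA; congr (_ * _).
    rewrite mulrCA [RHS]mulrCA; congr (_ * _).
    exact: conjc_graded (chi1 g) (Wg g x i' j).
Qed.

End GradedUnitary.

(** Stated for any compact group with a continuous character into the circle: a single element with
    nontrivial value already obstructs every n. *)
Lemma toeplitz_no_SLT_map (R : realType) (T : unitalCStarAlgType R)
    (P : vertex toeplitz_graph -> T) (S : edge toeplitz_graph -> T)
    (gamma : gaction (circle R) T) (G : compactGroupType) (chi : G -> circle R)
    (chiM : {morph chi : x y / (x * y)%g}) (chi_continuous : continuous chi)
    (g : G) (n : nat) :
  is_graph_algebra P S -> is_gauge_action P S gamma -> circle_val (chi g) != 1 ->
  ~ SLT_map_exists (gaction_restrict chiM chi_continuous gamma) n.
Proof.
move=> TG gg g1 [phi [phih phi1 phig]].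
have [psi [psih psi1 psig]] := toeplitz_representation TG gg.
have [I [dc [dr [W [[Wi Wc Wg] Ws]]]]] := graded_unitary_EG chiM chi_continuous n.
pose rho := psi \o phi; have rhoh : is_star_hom rho by exact: star_hom_comp.
have rho1 : rho aone = aone by rewrite /rho /= phi1.
have [_ rhoM rhos] := rhoh.
have rho0 : rho 0 = 0 by have := star_homZ 0 0 rhoh; rewrite !scale0r.
have rho_sum (F : I -> cfun R (EG R G n)) : rho (\sum_i F i) = \sum_i rho (F i).
  exact: (big_morph rho (star_homD rhoh) rho0).
have cfun_sum (F : I -> cfun R (EG R G n)) x : (\sum_i F i) x = \sum_i F i x.
  exact: (big_morph (fun f : cfun R (EG R G n) => f x : R[i])).
pose w := circle_val (chi g).
have rhog f : rho (ctrans g f) = conj_phase (circle_unimodular (chi g)) (rho f).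
  by rewrite /rho /= phig psig.
(* A homogeneous function satisfies a linear relation between [f] and its translate; [rho] carries
   it to [toep], where translation has become conjugation by the phase, that is, an intertwining
   relation. *)
have graded (f : cfun R (EG R G n)) (k l : nat) :
    (forall x, w ^+ k * f (gtrans x g) = w ^+ l * f x) ->
    forall y, w ^+ k *: phase (circle_unimodular (chi g)) (rho f y) =
      w ^+ l *: rho f (phase (circle_unimodular (chi g)) y).
  move=> fg y; have /(congr1 rho) : w ^+ k *: ctrans g f = w ^+ l *: f.
    by apply: cfunP => x; exact: fg.
  rewrite !(star_homZ _ _ rhoh) rhog => /(congr1 (fun a : toep R =>
    a (phase (circle_unimodular (chi g)) y))).
  by rewrite !toepZ conj_phaseE.
have : \sum_i w ^+ dr i = \sum_j w ^+ dc j.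
  apply: (graded_index_eq (w1 := circle_unimodular (chi g))
    (b := fun i j => rho (W i j))).
  - move=> j j'; transitivity (rho (\sum_i amul (star (W i j)) (W i j'))).
      by rewrite rho_sum; apply: eq_bigr => i _; rewrite rhoM rhos.
    rewrite -rho1 -(star_homZ _ _ rhoh); congr rho; apply: cfunP => x.
    by rewrite cfun_sum -[RHS]/(_ * 1) mulr1 -(Wi x).
  - move=> i i'; transitivity (rho (\sum_j amul (W i j) (star (W i' j)))).
      by rewrite rho_sum; apply: eq_bigr => j _; rewrite rhoM rhos.
    rewrite -rho1 -(star_homZ _ _ rhoh); congr rho; apply: cfunP => x.
    by rewrite cfun_sum -[RHS]/(_ * 1) mulr1 -(Wc x).
  - by move=> i j; apply: graded => x; exact: Wg.
  - move=> i j; rewrite -rhos; apply: graded => x.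
    exact: conjc_graded (circle_unimodular (chi g)) (Wg g x i j).
have := Ws w => + sumE; rewrite sumE subrr => /esym/eqP.
by rewrite expf_eq0 /= subr_eq0 eq_sym (negbTE g1).
Qed.

(** Cosine is strictly decreasing on [0, pi], so the real part alone differs from 1. *)
Lemma expi_neq1 (R : realType) (t : R) : 0 < t <= pi -> circle_val (expi t) != 1.
Proof.
move=> /andP[t0 tpi]; rewrite expiE eq_complex /= negb_and; apply/orP; left.
have : cos t < cos 0.
  by rewrite ltr_cos ?in_itv /= ?lexx ?pi_ge0 ?tpi ?(ltW t0).
by rewrite cos0 => /lt_eqF ->.
Qed.

Theorem theorem5p9 (R : realType) (k : nat) (k_ge2 : (2 <= k)%N)
  (T : unitalCStarAlgType R)
  (P : vertex toeplitz_graph -> T) (S : edge toeplitz_graph -> T)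
  (T_graph_algebra : is_graph_algebra P S)
  (gamma : gaction (circle R) T)
  (gamma_gauge : is_gauge_action P S gamma) :
  dim_SLT (restrict_unity_roots k_ge2 gamma) = +oo%E.
Proof.
rewrite /dim_SLT (_ : [set n | _] = set0) ?image_set0 ?ereal_inf0//.
apply/seteqP; split=> // n /=.
(* The generator 1 of Z/k has angle 2 pi / k, which is at most pi exactly because k >= 2. *)
apply: (toeplitz_no_SLT_map (g := (1%R : 'Z_k) : discrete_topology 'Z_k)
  T_graph_algebra gamma_gauge).
rewrite /unity_root [nat_of_ord _]/= expg1; apply: expi_neq1.
have k0 : 0 < k%:R :> R by rewrite ltr0n (ltn_trans _ k_ge2).
rewrite divr_gt0 ?mulr_gt0 ?pi_gt0//= ler_pdivrMr// mulrC.
by rewrite ler_wpM2l ?pi_ge0// ler_nat.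
Qed.
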